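(* The minimal discrepancy density for hyperbolic zero packing $$\rho_{\mathbb{H}}:=\liminf_{r\to1^-}\ \inf_f\ \frac{1}{\log\frac{1}{1-r^2}}\int_{\mathbb{D}(0,r)}\big((1-|z|^2)|f(z)|-1\big)^2\,\frac{\mathrm{d}A(z)}{1-|z|^2},$$ where the infimum runs over all polynomials $f$ (with complex coefficients), satisfies $$3.21\times 10^{-5}<\rho_{\mathbb{H}}\le 0.12087 .$$
   Context: $\mathbb{D}(0,r)=\{z\in\mathbb{C}:|z|<r\}$, and $\mathrm{d}A(z)=\frac{1}{\pi}\,\mathrm{d}x\,\mathrm{d}y$ ($z=x+\mathrm{i}y$) is the normalized area measure. Note that $\int_{\mathbb{D}(0,r)}\frac{\mathrm{d}A(z)}{1-|z|^2}=\log\frac{1}{1-r^2}$. *)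

(* Defs.v *)
From HB Require Import structures.
From mathcomp Require Import all_boot all_order all_algebra.
From mathcomp Require Import complex.
From mathcomp Require Import all_classical all_reals all_analysis.

Set Implicit Arguments.
Unset Strict Implicit.
Unset Printing Implicit Defensive.

Import Order.TTheory GRing.Theory Num.Theory.
Import numFieldNormedType.Exports.

Local Open Scope classical_set_scope.
Local Open Scope ring_scope.

Section hyperbolic_discrepancy.
Variable R : realType.

(* The product Lebesgue measure lives on [R * R]; a point [p] of it stands for
   the complex number [toC p]. *)
Local Notation mR := (measurableTypeR R).

Definition toC (p : mR * mR) : R[i] := (p.1 +i* p.2)%C.

(* The real-valued modulus: [`|z|] itself has type [R[i]]. *)
Definition cmod (z : R[i]) : R := complex.Re `|z|.

Definition disc (r : R) : set (mR * mR) := [set p | cmod (toC p) < r].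

Lemma pi_inv_ge0 : 0 <= (pi : R)^-1.
Proof. by rewrite invr_ge0 pi_ge0. Qed.

Definition dA : {measure set (mR * mR) -> \bar R} :=
  mscale (NngNum pi_inv_ge0) (lebesgue_measure \x lebesgue_measure)%E.

(* The integrand is nonnegative on [disc r] for [r <= 1], so the extended-real
   integral has its usual meaning. *)
Definition discrepancy (r : R) (f : {poly R[i]}) : \bar R :=
  ((ln (1 / (1 - r ^+ 2)))^-1%:E *
   \int[dA]_(p in disc r)
     (((1 - cmod (toC p) ^+ 2) * cmod f.[toC p] - 1) ^+ 2
        / (1 - cmod (toC p) ^+ 2))%:E)%E.

Definition rhoH : \bar R :=
  limf_einf
    (fun r : R => ereal_inf [set discrepancy r f | f in [set: {poly R[i]}]])
    1^'-.

End hyperbolic_discrepancy.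

(* Main.v *)
Require Import Defs.
From HB Require Import structures.
From mathcomp Require Import all_boot all_order all_algebra complex.
From mathcomp Require Import all_classical all_reals all_analysis.
From mathcomp Require Import measurable_realfun.
From mathcomp Require Import ring lra.

(** Write [u = (1 - |z|^2) |f(z)|], so that the discrepancy is the integral of
    [(u - 1)^2] against [dA / (1 - |z|^2)], divided by [ln (1 / (1 - r^2))].

    Lower bound.  On the disc [|w| < 1/2] no polynomial [P] keeps
    [(1 - |w|^2) |P(w)|] close to [1] (avg_discrepancy_ge).  Multiply [P] by a
    nonzero quadratic polynomial [p] that kills the coefficients of degrees one
    and two of [P p].  For a suitable radial weight [chi], the moments of
    [(1 - |w|^2)^2 chi] of orders [0, 3, 4, 5, ...] are nonpositive, so by Parseval
    the integral of [u^2 chi |p|^2] is nonpositive; yet that of [chi |p|^2] is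
    positive.  Hence [u] stays away from [1] in mean square.  The property is
    invariant under the automorphisms of the unit disc: [f] pulls back to a uniform
    limit of polynomials, and each image of [|w| < 1/2] under an automorphism
    contributes at least a constant times [1 - a^2], [a] being the modulus of the
    image of the origin (mobius_disc_discrepancy).  Such images are packed in rows,
    the row of index [n] filling the annulus [9^n / 3 < (1 + |z|)/(1 - |z|) < 3 * 9^n];
    each row holds enough disjoint discs to contribute [10^-4], and the number of
    rows in [|z| < r] is about [ln (1 / (1 - r^2)) / ln 9] (discrepancy_ge).

    Upper bound.  Take the lacunary polynomial [f = sum_n 4 b m_n z^(2 m_n)] with
    [m_n = 20^(n0 + n)].  Expanding the square, the discrepancy density is
    [(1 - s) |f|^2 - 2 |f| + 1 / (1 - s)] with [s = |z|^2].  Parseval bounds the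
    integral of the first term by [4 b^2] per mode; on the annulus
    [1 - 20 a / m_n <= s < 1 - a / m_n] the term [|f|] is at least the real part of
    [f] against the phase of its own mode, whose integral tends to
    [4 b (q - q^20)] with [q = e^-a]; the last term gives exactly
    [ln (1 / (1 - r^2))], which grows by [ln 20] per mode.  With [b] just below
    [q - q^20] the quotient tends to [1 - 4 b^2 / ln 20], and [q = 0.8541] makes
    this less than [0.12087] (discrepancy_le).

    Measure theory enters through three changes of variables: affine maps of the
    plane, from one-dimensional scaling and Tonelli's theorem; the inversion
    [z -> 1 / z], from the scale invariance of [dA / |z|^2]; and polar coordinates,
    in the form that [|z|^2] pushes normalized area to Lebesgue measure. *)

Set Implicit Arguments.
Unset Strict Implicit.
Unset Printing Implicit Defensive.
Import Order.TTheory GRing.Theory Num.Theory.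
Import numFieldNormedType.Exports.
Local Open Scope classical_set_scope.
Local Open Scope ring_scope.

(** * Affine changes of variables for Lebesgue measure *)

Section lebesgue_affine.
Variable R : realType.
Local Notation mR := (measurableTypeR R).
Local Notation leb := (@lebesgue_measure R).

Lemma integral_affine_line (a b : R) (f : mR -> \bar R) : 0 < a ->
  measurable_fun setT f -> (forall x, (0 <= f x)%E) ->
  (a%:E * \int[leb]_x f (a * x + b)%R = \int[leb]_x f x)%E.
Proof.
move=> a0 mf f0.
pose phi (x : mR) : mR := a * x + b.
have mphi : measurable_fun setT phi.
  by apply: measurable_funD => //; apply: measurable_funM.
pose k : {nonneg R} := NngNum (ltW a0).
pose P : {measure set mR -> \bar R} := @mscale _ _ R k
  (measure_function_pushforward__canonical__measure_function_Measure leb mphi).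
have leP A : measurable A -> leb A = P A.
  apply: lebesgue_measure_unique => _ [[x y] _ <-].
  change (leb `]x, y] = a%:E * leb (phi @^-1` `]x, y]))%E.
  have -> : phi @^-1` `]x, y] = `](x - b) / a, (y - b) / a]%classic.
    apply/seteqP; split => z /=; rewrite !in_itv/= /phi;
    by rewrite ltr_pdivrMr// ler_pdivlMr// ltrBlDr lerBrDr (mulrC a).
  rewrite !lebesgue_measure_itv/= !lte_fin ltr_pM2r ?invr_gt0// ltrD2r.
  case: ifP => xy; last by rewrite mule0.
  rewrite -!EFinD -EFinM; congr EFin; field; by rewrite gt_eqF.
transitivity (\int[P]_x f x)%E; last first.
  by apply: eq_measure_integral => A mA _; exact/esym/leP.
by rewrite ge0_integral_mscale//= ge0_integral_pushforward.
Qed.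

Lemma integral_opp_line (f : mR -> \bar R) :
  measurable_fun setT f -> (forall x, (0 <= f x)%E) ->
  (\int[leb]_x f (- x)%R = \int[leb]_x f x)%E.
Proof.
move=> mf f0.
pose phi (x : mR) : mR := - x.
have mphi : measurable_fun setT phi by exact: measurableT_comp.
pose P : {measure set mR -> \bar R} :=
  (measure_function_pushforward__canonical__measure_function_Measure leb mphi).
have leP A : measurable A -> leb A = P A.
  apply: lebesgue_measure_unique => _ [[x y] _ <-].
  change (leb `]x, y] = leb (phi @^-1` `]x, y]))%E.
  have -> : phi @^-1` `]x, y] = `[- y, - x[%classic.
    apply/seteqP; split => z /=; rewrite !in_itv/= /phi;
    by rewrite ltrNr lerNl andbC.
  rewrite !lebesgue_measure_itv/= !lte_fin ltrN2; case: ifP => // _.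
  by rewrite -!EFinB opprK addrC.
transitivity (\int[P]_x f x)%E; last first.
  by apply: eq_measure_integral => A mA _; exact/esym/leP.
by rewrite ge0_integral_pushforward.
Qed.

(** Plane Lebesgue measure, under a name of its own so that it is recognized as
    a sigma-finite measure when planes are multiplied in turn. *)
Definition lebesgue_plane : set (mR * mR) -> \bar R := (leb \x leb)%E.

HB.instance Definition _ := Measure.on lebesgue_plane.

Lemma sigma_finite_lebesgue_plane : sigma_finite setT lebesgue_plane.
Proof.
pose I n : set mR := `[- n%:R, n%:R]%classic.
exists (fun n => I n `*` I n); last first.
  move=> n; split; first by apply: measurableX; exact: measurable_itv.
  have In : (leb (I n) < +oo)%E.
    rewrite /I lebesgue_measure_itv/=.
    by case: ifP => _; rewrite ?ltry// -EFinD ltry.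
  rewrite /lebesgue_plane product_measure1E; [|exact: measurable_itv..].
  by rewrite lte_mul_pinfty// ge0_fin_numE.
apply/esym/seteqP; split => // -[x y] _.
exists (Num.trunc (Num.max `|x| `|y|)).+1 => //; split; rewrite /I /= in_itv /=;
  rewrite -ler_norml ltW// (le_lt_trans _ (truncnS_gt _))//;
  by rewrite le_max lexx ?orbT.
Qed.

HB.instance Definition _ :=
  Measure_isSigmaFinite.Build _ _ _ lebesgue_plane sigma_finite_lebesgue_plane.

Local Notation leb2 := lebesgue_plane.

Lemma integral_plane_xy (G : mR * mR -> \bar R) :
  measurable_fun setT G -> (forall p, (0 <= G p)%E) ->
  (\int[leb2]_p G p = \int[leb]_x \int[leb]_y G (x, y))%E.
Proof. by move=> mG G0; rewrite /lebesgue_plane (fubini_tonelli1 _ mG G0). Qed.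

Lemma integral_plane_yx (G : mR * mR -> \bar R) :
  measurable_fun setT G -> (forall p, (0 <= G p)%E) ->
  (\int[leb2]_p G p = \int[leb]_y \int[leb]_x G (x, y))%E.
Proof. by move=> mG G0; rewrite /lebesgue_plane (fubini_tonelli2 _ mG G0). Qed.

Lemma measurable_inner_integral (G : mR * mR -> \bar R) :
  measurable_fun setT G -> (forall p, (0 <= G p)%E) ->
  measurable_fun setT (fun x : mR => \int[leb]_y G (x, y))%E.
Proof. by move=> mG G0; exact: (measurable_fun_fubini_tonelli_F _ mG G0). Qed.

Lemma integral_opp_plane (G : mR * mR -> \bar R) :
  measurable_fun setT G -> (forall p, (0 <= G p)%E) ->
  (\int[leb2]_p G (- p.1, - p.2)%R = \int[leb2]_p G p)%E.
Proof.
move=> mG G0.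
have mG' : measurable_fun setT (fun p : mR * mR => G (- p.1, - p.2)).
  apply: (@measurableT_comp _ _ _ _ _ _ G) => //.
  by apply: measurable_fun_pair => /=; exact: measurableT_comp.
rewrite integral_plane_xy; [|exact: mG'|by []].
rewrite [RHS]integral_plane_xy; [|exact: mG|by []].
have I0 (x : mR) : (0 <= \int[leb]_y G (x, y))%E by exact: integral_ge0.
rewrite -[RHS](integral_opp_line (measurable_inner_integral mG G0) I0).
apply: eq_integral => x _ /=.
rewrite (integral_opp_line (f := fun y => G (- x, y)))//.
exact: measurable_fun_pair2.
Qed.

(** Similarities of positive real part: a shear, which preserves each horizontal
    line, followed by a triangular map. *)
Lemma integral_rot_pos (c d u v : R) (G : mR * mR -> \bar R) : 0 < u ->
  measurable_fun setT G -> (forall p, (0 <= G p)%E) ->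
  ((u ^+ 2 + v ^+ 2)%:E *
     \int[leb2]_p G (c + u * p.1 - v * p.2, d + v * p.1 + u * p.2)%R
   = \int[leb2]_p G p)%E.
Proof.
move=> u0 mG G0.
have mlin (a b e : R) : measurable_fun setT (fun p : mR * mR => a + b * p.1 + e * p.2).
  by apply: measurable_funD; [apply: measurable_funD => //|]; apply: measurable_funM.
have mcomp (a b e a' b' e' : R) : measurable_fun setT
    (fun p : mR * mR => G (a + b * p.1 + e * p.2, a' + b' * p.1 + e' * p.2)).
  apply: (@measurableT_comp _ _ _ _ _ _ G) => //.
  by apply: measurable_fun_pair => /=; exact: mlin.
set N := u ^+ 2 + v ^+ 2.
have N0 : 0 < N by rewrite ltr_wpDr ?sqr_ge0// exprn_gt0.
pose H (p : mR * mR) := G (c + u * p.1 + (- v) * p.2, d + v * p.1 + u * p.2).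
have HE : (\int[leb2]_p H p =
  \int[leb]_x \int[leb]_y G (c + u * x, d + v * x + N / u * y)%R)%E.
  pose K (p : mR * mR) := G (c + u * p.1 + 0 * p.2, d + v * p.1 + N / u * p.2).
  transitivity (\int[leb2]_p K p)%E; last first.
    rewrite integral_plane_xy; [|exact: mcomp|by move=> p; exact: G0].
    apply: eq_integral => x _; apply: eq_integral => y _.
    by rewrite /K /= mul0r addr0.
  rewrite integral_plane_yx; [|exact: mcomp|by move=> p; exact: G0].
  rewrite [RHS]integral_plane_yx; [|exact: mcomp|by move=> p; exact: G0].
  apply: eq_integral => y _.
  have mHy : measurable_fun setT (fun x : mR => H (x, y)).
    exact: (measurable_fun_pair1 y (mcomp c u (- v) d v u)).
  rewrite -[LHS](integral_affine_line (v / u * y) ltr01 mHy (fun x => G0 _)) mul1e.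
  apply: eq_integral => x _; rewrite /H /K /= /N; congr (G (_, _)); field;
  by rewrite gt_eqF.
transitivity (N%:E * \int[leb2]_p H p)%E.
  by congr (_ * _)%E; apply: eq_integral => p _; rewrite /H mulNr.
rewrite HE [RHS]integral_plane_xy; [|exact: mG|by []].
have I0 (x : mR) : (0 <= \int[leb]_y G (x, y))%E by exact: integral_ge0.
rewrite -[RHS](integral_affine_line c u0 (measurable_inner_integral mG G0) I0).
have -> : N%:E = (u%:E * (N / u)%:E)%E.
  by rewrite -EFinM; congr EFin; field; rewrite gt_eqF.
have mK : measurable_fun setT
   (fun p : mR * mR => G (c + u * p.1, d + v * p.1 + N / u * p.2)).
  have := mcomp c u 0 d v (N / u).
  by under eq_fun do rewrite mul0r addr0.
rewrite -muleA; congr (_ * _)%E.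
rewrite -ge0_integralZl//; last 3 first.
- exact: (measurable_inner_integral mK (fun p => G0 _)).
- by move=> x _; exact: integral_ge0.
- by rewrite lee_fin divr_ge0// ltW.
apply: eq_integral => x _.
rewrite -[RHS](@integral_affine_line (N / u) (d + v * x))//.
- congr (_ * _)%E; apply: eq_integral => y _.
  by rewrite (addrC (u * x)) (addrC (N / u * y)).
- by rewrite divr_gt0.
- exact: (measurable_fun_pair2 _ mG).
Qed.

End lebesgue_affine.

(** * Modulus and measurability of complex functions *)

Section complex_measurability.
Variable R : realType.
Local Notation mR := (measurableTypeR R).
Local Notation Re := (@complex.Re R).
Local Notation Im := (@complex.Im R).

(** The squared modulus, as an element of [R]. *)
Definition nsq (z : R[i]) : R := Re z ^+ 2 + Im z ^+ 2.

Lemma nsq_ge0 z : 0 <= nsq z. Proof. by rewrite addr_ge0// sqr_ge0. Qed.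
Lemma nsq0 : nsq 0 = 0. Proof. by rewrite /nsq /= expr0n addr0. Qed.
Lemma nsq1 : nsq 1 = 1. Proof. by rewrite /nsq /= expr0n expr1n addr0. Qed.
Lemma nsqM z w : nsq (z * w) = nsq z * nsq w.
Proof. by case: z w => [a b] [c d]; rewrite /nsq /=; ring. Qed.
Lemma nsqN z : nsq (- z) = nsq z.
Proof. by case: z => [a b]; rewrite /nsq /= !sqrrN. Qed.
Lemma nsqX z n : nsq (z ^+ n) = nsq z ^+ n.
Proof. by elim: n => [|n IH]; rewrite ?expr0 ?nsq1// !exprS nsqM IH. Qed.
Lemma nsq_conj z : nsq (conjc z) = nsq z.
Proof. by case: z => [a b]; rewrite /nsq /= sqrrN. Qed.
Lemma nsq_eq0 z : (nsq z == 0) = (z == 0).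
Proof.
case: z => [a b]; rewrite /nsq /= paddr_eq0 ?sqr_ge0// !sqrf_eq0.
by rewrite eq_complex.
Qed.
Lemma nsq_gt0 z : (0 < nsq z) = (z != 0).
Proof. by rewrite lt_def nsq_ge0 andbT nsq_eq0. Qed.
Lemma nsqV z : nsq z^-1 = (nsq z)^-1.
Proof.
have [->|z0] := eqVneq z 0; first by rewrite invr0 nsq0 invr0.
apply: (mulfI (x := nsq z)); first by rewrite nsq_eq0.
by rewrite -nsqM divff// nsq1 divff// nsq_eq0.
Qed.
Lemma nsq_real (x : R) : nsq (x%:C%C) = x ^+ 2.
Proof. by rewrite /nsq /= expr0n addr0. Qed.
Lemma conjcM_nsq (z : R[i]) : conjc z * z = (nsq z)%:C%C.
Proof.
by case: z => [a b]; apply/eqP; rewrite eq_complex /nsq /=; apply/andP;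
  split; apply/eqP; ring.
Qed.

Lemma cmodE (z : R[i]) : cmod z = Num.sqrt (nsq z).
Proof. by rewrite /cmod normc_def. Qed.
Lemma cmod_ge0 (z : R[i]) : 0 <= cmod z. Proof. by rewrite cmodE sqrtr_ge0. Qed.
Lemma cmod_sqr (z : R[i]) : cmod z ^+ 2 = nsq z.
Proof. by rewrite cmodE sqr_sqrtr// nsq_ge0. Qed.
Lemma cmod_lt (z : R[i]) r : 0 <= r -> (cmod z < r) = (nsq z < r ^+ 2).
Proof.
by move=> r0; rewrite -cmod_sqr ltr_pXn2r// nnegrE cmod_ge0.
Qed.
Lemma cmod_real (z : R[i]) : `|z| = (cmod z)%:C%C.
Proof. by rewrite /cmod normc_def. Qed.
Lemma cmodM (z w : R[i]) : cmod (z * w) = cmod z * cmod w.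
Proof. by rewrite !cmodE nsqM sqrtrM// nsq_ge0. Qed.
Lemma cmodD (z w : R[i]) : cmod (z + w) <= cmod z + cmod w.
Proof. by rewrite -lecR rmorphD /= -!cmod_real ler_normD. Qed.
Lemma cmodN (z : R[i]) : cmod (- z) = cmod z.
Proof. by rewrite !cmodE nsqN. Qed.
Lemma cmodV (z : R[i]) : cmod z^-1 = (cmod z)^-1.
Proof. by rewrite !cmodE nsqV sqrtrV// nsq_ge0. Qed.
Lemma cmod0 : cmod (0 : R[i]) = 0. Proof. by rewrite cmodE nsq0 sqrtr0. Qed.
Lemma cmod1 : cmod (1 : R[i]) = 1. Proof. by rewrite cmodE nsq1 sqrtr1. Qed.
Lemma cmodX (z : R[i]) n : cmod (z ^+ n) = cmod z ^+ n.
Proof. by elim: n => [|n IH]; rewrite ?expr0 ?cmod1// !exprS cmodM IH. Qed.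
Lemma norm_Re_le_cmod (z : R[i]) : `|Re z| <= cmod z.
Proof.
rewrite -(@ler_pXn2r _ 2)// ?nnegrE ?cmod_ge0//.
by rewrite cmod_sqr real_normK ?num_real// lerDl sqr_ge0.
Qed.
Lemma Re_le_cmod (z : R[i]) : Re z <= cmod z.
Proof. exact: le_trans (ler_norm _) (norm_Re_le_cmod z). Qed.

Lemma Re_sum (J : Type) (s : seq J) (F : J -> R[i]) :
  Re (\sum_(j <- s) F j) = \sum_(j <- s) Re (F j).
Proof. by elim/big_rec2: _ => // j x y _ <-; case: (F j) y => ? ? []. Qed.

(** The point of the plane that stands for [z], inverse to [toC]. *)
Definition ofC (z : R[i]) : mR * mR := (Re z, Im z).
Lemma ofCK z : toC (ofC z) = z. Proof. by case: z. Qed.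

Lemma measurable_fun_inv d (T : measurableType d) (f : T -> R) :
  (forall x, 0 <= f x) -> measurable_fun setT f ->
  measurable_fun setT (fun x => (f x)^-1).
Proof.
move=> f0 mf; rewrite (_ : (fun x => _) = (fun x => powR (f x) (-1))); last first.
  by apply/funext => x; rewrite powR_inv1.
apply: (@measurableT_comp _ _ _ _ _ _ (fun y => powR y (-1))) => //.
Qed.

Lemma measurable_fun_sqrt d (T : measurableType d) (f : T -> R) :
  measurable_fun setT f -> measurable_fun setT (fun x => Num.sqrt (f x)).
Proof.
move=> mf; apply: (@measurableT_comp _ _ _ _ _ _ (@Num.sqrt R)) => //.
by apply: continuous_measurable_fun; exact: sqrt_continuous.
Qed.

Section measC.
Context d (T : measurableType d).

(** Measurability of a complex-valued function, by its real and imaginary parts. *)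
Definition measC (g : T -> R[i]) :=
  measurable_fun setT (fun x => Re (g x)) /\
  measurable_fun setT (fun x => Im (g x)).

Lemma measC_cst c : measC (fun=> c). Proof. by split. Qed.

Lemma measCD f g : measC f -> measC g -> measC (fun x => f x + g x).
Proof.
move=> [f1 f2] [g1 g2]; split.
- rewrite (_ : (fun x => _) = fun x => Re (f x) + Re (g x)).
    exact: measurable_funD.
  by apply/funext => x; case: (f x) (g x) => [? ?] [].
- rewrite (_ : (fun x => _) = fun x => Im (f x) + Im (g x)).
    exact: measurable_funD.
  by apply/funext => x; case: (f x) (g x) => [? ?] [].
Qed.

Lemma measCM f g : measC f -> measC g -> measC (fun x => f x * g x).
Proof.
move=> [f1 f2] [g1 g2]; split.
- rewrite (_ : (fun x => _) = fun x => Re (f x) * Re (g x) - Im (f x) * Im (g x)).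
    by apply: measurable_funB; exact: measurable_funM.
  by apply/funext => x; case: (f x) (g x) => [? ?] [].
- rewrite (_ : (fun x => _) = fun x => Re (f x) * Im (g x) + Im (f x) * Re (g x)).
    by apply: measurable_funD; exact: measurable_funM.
  by apply/funext => x; case: (f x) (g x) => [? ?] [].
Qed.

Lemma measCN f : measC f -> measC (fun x => - f x).
Proof.
move=> mf; rewrite (_ : (fun x => _) = fun x => (-1) * f x).
  by apply: measCM => //; exact: measC_cst.
by apply/funext => x; rewrite mulN1r.
Qed.

Lemma measC_conj f : measC f -> measC (fun x => conjc (f x)).
Proof.
move=> [f1 f2]; split.
- rewrite (_ : (fun x => _) = fun x => Re (f x))//.
  by apply/funext => x; case: (f x).
- rewrite (_ : (fun x => _) = fun x => - Im (f x)); first exact: measurableT_comp.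
  by apply/funext => x; case: (f x).
Qed.

Lemma measurable_nsq f : measC f -> measurable_fun setT (fun x => nsq (f x)).
Proof.
by move=> [f1 f2]; apply: measurable_funD; exact: measurable_funX.
Qed.

Lemma measurable_cmod f : measC f -> measurable_fun setT (fun x => cmod (f x)).
Proof.
move=> mf; under eq_fun do rewrite cmodE.
by apply: measurable_fun_sqrt; exact: measurable_nsq.
Qed.

Lemma measCV f : measC f -> measC (fun x => (f x)^-1).
Proof.
move=> mf; have mn : measurable_fun setT (fun x => (nsq (f x))^-1).
  apply: measurable_fun_inv; last exact: measurable_nsq.
  by move=> x; exact: nsq_ge0.
split.
- rewrite (_ : (fun x => _) = fun x => Re (f x) * (nsq (f x))^-1).
    by apply: measurable_funM => //; case: mf.
  by apply/funext => x; case: (f x).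
- rewrite (_ : (fun x => _) = fun x => (- Im (f x)) * (nsq (f x))^-1).
    apply: measurable_funM => //; apply: measurableT_comp => //; by case: mf.
  by apply/funext => x; case: (f x) => a b; rewrite /nsq /= mulNr.
Qed.

Lemma measCX f n : measC f -> measC (fun x => f x ^+ n).
Proof.
move=> mf; elim: n => [|n IH]; first by under eq_fun do rewrite expr0; exact: measC_cst.
by under eq_fun do rewrite exprS; exact: measCM.
Qed.

Lemma measC_horner (P : {poly R[i]}) f : measC f -> measC (fun x => P.[f x]).
Proof.
move=> mf; elim/poly_ind: P => [|P c IH].
  by under eq_fun do rewrite horner0; exact: measC_cst.
under eq_fun do rewrite hornerMXaddC.
by apply: measCD; [exact: measCM|exact: measC_cst].
Qed.

Lemma measurable_ofC f : measC f -> measurable_fun setT (fun x => ofC (f x)).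
Proof. by move=> [f1 f2]; apply: measurable_fun_pair. Qed.

(** Composition of measurable functions through the plane, [F] being measurable as a
    function of the point of [R * R] that stands for its argument. *)
Lemma measurable_compC (F : R[i] -> \bar R) f :
  measurable_fun setT (fun p => F (toC p)) -> measC f ->
  measurable_fun setT (fun x => F (f x)).
Proof.
move=> mF /measurable_ofC mf.
rewrite (_ : (fun x => F (f x)) = (fun p => F (toC p)) \o (fun x => ofC (f x))).
  exact: measurableT_comp.
by apply/funext => x /=; rewrite ofCK.
Qed.

End measC.

Lemma measC_toC : measC (@toC R).
Proof. by split => /=; [exact: measurable_fst|exact: measurable_snd]. Qed.

End complex_measurability.

Lemma measurable_bool_indicator (R : realType) d (T : measurableType d)
  (b : T -> bool) : measurable_fun setT b ->
  measurable_fun setT (fun x => (b x)%:R : R).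
Proof.
move=> mb; rewrite (_ : (fun x => _) = (fun x => if b x then 1 else 0 : R)).
  exact: measurable_fun_ifT.
by apply/funext => x; case: (b x).
Qed.

(** * Change of variables under Moebius maps *)

Section plane_change_of_variables.
Variable R : realType.
Local Notation mR := (measurableTypeR R).
Local Notation leb := (@lebesgue_measure R).
Local Notation leb2 := (@lebesgue_plane R).
Local Notation Re := (@complex.Re R).
Implicit Types (F : R[i] -> \bar R) (z w : R[i]).

(** Measurability of an extended-real function of a complex variable. *)
Definition measP F := measurable_fun setT (fun p : mR * mR => F (toC p)).

(** Integral over the complex plane for the unnormalized Lebesgue measure. *)
Definition planar F := (\int[leb2]_p F (toC p))%E.

Lemma measP_comp F (g : R[i] -> R[i]) : measP F ->
  measC (fun p : mR * mR => g (toC p)) -> measP (F \o g).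
Proof. by move=> mF mg; exact: (measurable_compC mF mg). Qed.

Lemma measP_mul F (h : R[i] -> R) : measP F ->
  measurable_fun setT (fun p : mR * mR => h (toC p)) ->
  measP (fun z => F z * (h z)%:E)%E.
Proof.
move=> mF mh; apply: emeasurable_funM => //.
exact/measurable_EFinP.
Qed.

Lemma measC_affine (b l : R[i]) : measC (fun p : mR * mR => b + l * toC p).
Proof.
apply: measCD; first exact: measC_cst.
by apply: measCM; [exact: measC_cst|exact: measC_toC].
Qed.

Let planar_affine_pos b l F : measP F -> (forall z, (0 <= F z)%E) -> 0 < Re l ->
  ((nsq l)%:E * planar (fun z => F (b + l * z)%R) = planar F)%E.
Proof.
case: b l => [c d] [u v] mF F0 /= u0.
rewrite /planar -(@integral_rot_pos R c d u v _ u0 mF) //.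
congr (_ * _)%E; apply: eq_integral => -[x y] _ /=; congr F; rewrite /toC /=.
by apply/eqP; rewrite eq_complex /=; apply/andP; split; apply/eqP; ring.
Qed.

Lemma planar_opp F : measP F -> (forall z, (0 <= F z)%E) ->
  planar (fun z => F (- z)) = planar F.
Proof.
move=> mF F0; rewrite /planar -[RHS]integral_opp_plane//.
Qed.

Lemma planar_affine b l F : measP F -> (forall z, (0 <= F z)%E) -> l != 0 ->
  ((nsq l)%:E * planar (fun z => F (b + l * z)%R) = planar F)%E.
Proof.
move=> mF F0.
(* The case of nonzero real part, by a half-turn when it is negative. *)
have H (l' : R[i]) b' G : Re l' != 0 -> measP G -> (forall z, (0 <= G z)%E) ->
    ((nsq l')%:E * planar (fun z => G (b' + l' * z)%R) = planar G)%E.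
  move=> l0 mG G0; have [lp|ln|l00] := ltgtP 0 (Re l').
  - exact: planar_affine_pos.
  - rewrite -(@planar_affine_pos b' (- l') G)//; last first.
      by case: l' ln {l0} => u v /=; rewrite oppr_gt0.
    rewrite nsqN -[in LHS]planar_opp//; last first.
      by apply: (measP_comp (g := fun z => b' + l' * z)) => //; exact: measC_affine.
    by congr (_ * _)%E; apply: eq_integral => p _; rewrite mulrN mulNr.
  - by rewrite l00 eqxx in l0.
case: l => [u v]; have [->|u0 _] := eqVneq u 0; last exact: H.
rewrite eq_complex /= eqxx /= => v0.
(* A purely imaginary factor is a product of two with nonzero real part. *)
pose l1 := @Complex R 1 1; pose l2 := Complex (v / 2) (v / 2).
have l12 : Complex 0 v = l1 * l2.
  by apply/eqP; rewrite eq_complex /=; apply/andP; split; apply/eqP; field.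
have v2 : v / 2 != 0 by rewrite mulf_neq0// invr_eq0 pnatr_eq0.
have r1 : Re l1 != 0 by rewrite oner_eq0.
have mF1 : measP (fun z => F (b + l1 * z)).
  by apply: (measP_comp (g := fun z => b + l1 * z)) => //; exact: measC_affine.
rewrite -[RHS](H l1 b _ r1 mF F0).
rewrite -(H l2 0 (fun z => F (b + l1 * z)) v2 mF1)//.
rewrite muleA -EFinM -nsqM -l12; congr (_ * _)%E.
by apply: eq_integral => p _; rewrite add0r mulrA -l12.
Qed.

Lemma planar_swap (G : R[i] -> R[i] -> \bar R) :
  measurable_fun setT (fun q : (mR * mR) * (mR * mR) => G (toC q.1) (toC q.2)) ->
  (forall z w, (0 <= G z w)%E) ->
  planar (fun z => planar (G z)) = planar (fun w => planar (G ^~ w)).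
Proof.
move=> mG G0; rewrite /planar.
exact: (@fubini_tonelli _ _ _ _ _ leb2 leb2
  (fun q : (mR * mR) * (mR * mR) => G (toC q.1) (toC q.2))).
Qed.

Lemma planarZl F (k : \bar R) : measP F -> (forall z, (0 <= F z)%E) ->
  (0 <= k)%E -> (planar (fun z => k * F z) = k * planar F)%E.
Proof. by move=> mF F0 k0; rewrite /planar ge0_integralZl. Qed.

(** Integral for the scale-invariant measure [dx dy / |z|^2]; its density [W] is [0]
    at the origin. *)
Let W (z : R[i]) : R := (nsq z)^-1.
Let haar F := planar (fun z => F z * (W z)%:E)%E.

Let W_ge0 z : 0 <= W z. Proof. by rewrite invr_ge0 nsq_ge0. Qed.

Let measW d (T : measurableType d) (g : T -> R[i]) : measC g ->
  measurable_fun setT (fun x => W (g x)).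
Proof.
move=> mg; apply: measurable_fun_inv; last exact: measurable_nsq.
by move=> x; exact: nsq_ge0.
Qed.

Let haar_scale F l : measP F -> (forall z, (0 <= F z)%E) -> l != 0 ->
  haar (fun z => F (l * z)) = haar F.
Proof.
move=> mF F0 l0; rewrite /haar.
rewrite -[RHS](@planar_affine 0 l)//; last 2 first.
- by apply: measP_mul => //; apply: measW; exact: measC_toC.
- by move=> z; rewrite mule_ge0// lee_fin.
rewrite -planarZl ?lee_fin ?nsq_ge0//; last 2 first.
- apply: (@measP_comp (fun z => F z * (W z)%:E)%E (fun z => 0 + l * z)).
    by apply: measP_mul => //; apply: measW; exact: measC_toC.
  exact: measC_affine.
- by move=> z; rewrite mule_ge0// lee_fin.
apply: eq_integral => p _; rewrite add0r muleCA; congr (_ * _)%E.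
rewrite -EFinM; congr EFin; rewrite /W nsqM invfM mulrA mulfV ?mul1r//.
by rewrite nsq_eq0.
Qed.

(** The indicator of an annulus, of finite positive mass for that measure. *)
Let K (z : R[i]) : \bar R := (((1 <= nsq z) && (nsq z < 4))%:R : R)%:E.

Let K0 z : (0 <= K z)%E. Proof. by rewrite lee_fin ler0n. Qed.

Let measK d (T : measurableType d) (g : T -> R[i]) : measC g ->
  measurable_fun setT (fun x => K (g x)).
Proof.
move=> mg; apply/measurable_EFinP; apply: measurable_bool_indicator.
have mn := measurable_nsq mg.
apply: measurable_and; first exact: measurable_fun_ler.
exact: measurable_fun_ltr.
Qed.

Let haarK_fin : (haar K < +oo)%E.
Proof.
pose Q : set (mR * mR) := (`[(-2 : R), 2] `*` `[(-2 : R), 2])%classic.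
have mQ : measurable Q by apply: measurableX; exact: measurable_itv.
have : (leb2 Q < +oo)%E.
  have I : leb `[(-2 : R), 2]%classic = 4%:E.
    by rewrite lebesgue_measure_itv/= lte_fin gtrN// -EFinD; congr EFin; ring.
  rewrite /lebesgue_plane product_measure1E; [|exact: measurable_itv..].
  by rewrite [X in (X * X)%E]I -EFinM ltry.
apply: le_lt_trans.
have <- : (\int[leb2]_p (\1_Q p)%:E = leb2 Q)%E by rewrite integral_indic// setIT.
apply: ge0_le_integral => //.
- by move=> p _; rewrite mule_ge0// lee_fin.
- apply: emeasurable_funM; first by apply: measK; exact: measC_toC.
  by apply/measurable_EFinP; apply: measW; exact: measC_toC.
- by apply/measurable_EFinP; exact: measurable_indic.
move=> [x y] _; rewrite -EFinM lee_fin indicE.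
have [/andP[n1 n4]|_] := boolP (_ && _); last by rewrite mul0r.
rewrite mem_set/=; first by rewrite mul1r /W invf_le1// (lt_le_trans ltr01).
have hx (t : R) : t ^+ 2 < 4 -> -2 <= t <= 2.
  move=> h; rewrite -ler_norml -(@ler_pXn2r _ 2)// ?nnegrE//.
  by rewrite real_normK ?num_real//; lra.
rewrite /Q /= !in_itv/= ; rewrite /nsq /= in n1 n4.
by split; apply: hx; apply: le_lt_trans n4; rewrite ?lerDl ?lerDr sqr_ge0.
Qed.

Let haarK_gt0 : (0 < haar K)%E.
Proof.
pose Q : set (mR * mR) := (`[(1 : R), 3 / 2] `*` `[(0 : R), 1])%classic.
have mQ : measurable Q by apply: measurableX; exact: measurable_itv.
have : (0 < (4^-1)%:E * leb2 Q)%E.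
  have I1 : leb `[(1 : R), 3 / 2]%classic = (1 / 2)%:E.
    have h : (1 < 3 / 2 :> R) by lra.
    by rewrite lebesgue_measure_itv/= lte_fin h -EFinD; congr EFin; field.
  have I2 : leb `[(0 : R), 1]%classic = 1%:E.
    by rewrite lebesgue_measure_itv/= lte_fin ltr01 -EFinD subr0.
  rewrite /lebesgue_plane product_measure1E; [|exact: measurable_itv..].
  by rewrite [X in (_ * (X * _))%E]I1 [X in (_ * (_ * X))%E]I2 -!EFinM lte_fin; lra.
move=> /lt_le_trans; apply.
have <- : (\int[leb2]_p (\1_Q p)%:E = leb2 Q)%E by rewrite integral_indic// setIT.
rewrite -ge0_integralZl//; last first.
  by apply/measurable_EFinP; exact: measurable_indic.
apply: ge0_le_integral => //.
- by apply/measurable_EFinP; apply: measurable_funM => //; exact: measurable_indic.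
- apply: emeasurable_funM; first by apply: measK; exact: measC_toC.
  by apply/measurable_EFinP; apply: measW; exact: measC_toC.
move=> [x y] _; rewrite -!EFinM lee_fin indicE.
have [|_] := boolP ((x, y) \in Q); last by rewrite mulr0 mulr_ge0// ler0n.
rewrite inE => -[/=]; rewrite !in_itv/= => /andP[x1 x2] /andP[y1 y2].
have h1 : 1 <= nsq (toC (x, y)) by rewrite /nsq /=; nra.
have h4 : nsq (toC (x, y)) < 4 by rewrite /nsq /=; nra.
rewrite h1 h4 mul1r mulr1 /W lef_pV2 ?posrE ?ltW//; lra.
Qed.

(** Invariance under inversion follows from invariance under scaling: the double
    integral of [F (z^-1) K (z w)] is the mass of [K] times the integral of
    [F (z^-1)]; if instead [z] and then [w] are rescaled, it is the mass of [K] times the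
    integral of [F]. *)
Let haar_inv F : measP F -> (forall z, (0 <= F z)%E) ->
  haar (fun z => F (z^-1)%R) = haar F.
Proof.
move=> mF F0.
have mz := @measC_toC R.
have ac4 (a b c d : \bar R) : (a * b * (c * d) = d * (a * c * b))%E.
  by rewrite muleACA muleA muleC.
have W00 : W 0 = 0 by rewrite /W nsq0 invr0.
have m1 : measC (fun q : (mR * mR) * (mR * mR) => toC q.1).
  by split => /=; apply: (measurableT_comp _ measurable_fst).
have m2 : measC (fun q : (mR * mR) * (mR * mR) => toC q.2).
  by split => /=; apply: (measurableT_comp _ measurable_snd).
have mFi : measP (fun z => F z^-1).
  by apply: (measurable_compC mF); exact: measCV.
have mWE d (T : measurableType d) (g : T -> R[i]) : measC g ->
    measurable_fun setT (fun x => (W (g x))%:E).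
  by move=> mg; apply/measurable_EFinP; exact: measW.
suff : (haar K * haar (fun z => F (z^-1)%R) = haar K * haar F)%E.
  move: haarK_fin haarK_gt0; case: (haar K) => [k| |]//= _.
  rewrite lte_fin => k0 /(congr1 (mule (k^-1)%:E)).
  by rewrite !muleA -EFinM mulVf ?gt_eqF// !mul1e.
have scaleE (k : R) G : 0 <= k -> measP G -> (forall z, (0 <= G z)%E) ->
    planar (fun z => (k%:E * G z)%E) = (k%:E * planar G)%E.
  by move=> k0 mG G0; rewrite planarZl// lee_fin.
transitivity (planar (fun z => planar (fun w =>
    F (z^-1)%R * (W z)%:E * (K (z * w)%R * (W w)%:E))))%E.
  rewrite [X in (_ * X)%E]/haar -planarZl; last 3 first.
  - by apply: emeasurable_funM => //; apply: mWE; exact: mz.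
  - by move=> z; rewrite mule_ge0// lee_fin.
  - exact: ltW haarK_gt0.
  apply: eq_integral => p _; set z := toC p.
  have [z0|z0] := eqVneq z 0.
    rewrite z0 W00 !mule0 /planar integral0_eq// => q _.
    by rewrite mul0e.
  rewrite -(@haar_scale K z)//; last by apply: measK; exact: mz.
  rewrite muleC [X in (_ * X)%E]/haar -planarZl//.
  - apply: emeasurable_funM; last by apply: mWE; exact: mz.
    by apply: measK; apply: measCM; [exact: measC_cst|exact: mz].
  - by move=> w; rewrite mule_ge0// lee_fin.
  - by rewrite mule_ge0// lee_fin.
rewrite planar_swap; last 2 first.
- apply: emeasurable_funM.
    apply: emeasurable_funM; last exact: mWE.
    exact: (measurable_compC mF (measCV m1)).
  by apply: emeasurable_funM; [apply: measK; exact: measCM|exact: mWE].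
- by move=> z w; rewrite !mule_ge0// lee_fin.
transitivity (planar (fun w => planar (fun z =>
    F (z^-1 * w)%R * (W z)%:E * (K z * (W w)%:E))))%E.
  apply: eq_integral => p _; set w := toC p.
  have [w0|w0] := eqVneq w 0.
    by apply: eq_integral => q _; rewrite w0 W00 !mule0.
  have mFw : measP (fun z => F (z^-1 * w)).
    apply: (measurable_compC mF); apply: measCM; last exact: measC_cst.
    exact: measCV.
  have mPhi : measP (fun z => F (z^-1 * w)%R * K z)%E.
    by apply: emeasurable_funM => //; apply: measK; exact: mz.
  transitivity ((W w)%:E * haar (fun z => F ((w * z)^-1 * w)%R * K (w * z)%R))%E.
    rewrite -scaleE//.
    - apply: eq_integral => q _; rewrite invfM mulrAC mulVf// mul1r.
      by rewrite [toC q * w]mulrC ac4.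
    - apply: emeasurable_funM; last by apply: mWE; exact: mz.
      apply: (@measP_comp (fun z => F (z^-1 * w)%R * K z)%E (fun z => w * z)) => //.
      by apply: measCM; [exact: measC_cst|exact: mz].
    - by move=> z; rewrite !mule_ge0// lee_fin.
  rewrite (@haar_scale (fun z => F (z^-1 * w)%R * K z)%E w)//; last first.
    by move=> z; rewrite mule_ge0.
  rewrite -scaleE//.
  - by apply: eq_integral => q _; rewrite ac4.
  - by apply: emeasurable_funM => //; apply: mWE; exact: mz.
  - by move=> z; rewrite !mule_ge0// lee_fin.
rewrite -planar_swap; last 2 first.
- apply: emeasurable_funM.
    apply: emeasurable_funM; last exact: mWE.
    by apply: (measurable_compC mF); apply: measCM => //; exact: measCV.
  by apply: emeasurable_funM; [exact: measK|exact: mWE].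
- by move=> z w; rewrite !mule_ge0// lee_fin.
rewrite [RHS]muleC [X in (_ * X)%E]/haar -planarZl; last 3 first.
- by apply: emeasurable_funM; [apply: measK; exact: mz|apply: mWE; exact: mz].
- by move=> z; rewrite mule_ge0// lee_fin.
- by apply: integral_ge0 => p _; rewrite mule_ge0// lee_fin.
apply: eq_integral => p _; set z := toC p.
have [z0|z0] := eqVneq z 0.
  rewrite z0 W00 !mule0 /planar integral0_eq// => q _.
  by rewrite mule0 mul0e.
rewrite -(@haar_scale F z^-1)// ?invr_eq0// [RHS]muleC.
rewrite [X in _ = (_ * X)%E]/haar -planarZl//.
- apply: eq_integral => q _.
  by rewrite [X in (X * _)%E = _]muleC muleACA [X in (X * _)%E = _]muleC.
- apply: emeasurable_funM; last by apply: mWE; exact: mz.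
  by apply: (measurable_compC mF); apply: measCM; [exact: measC_cst|exact: mz].
- by move=> w; rewrite mule_ge0// lee_fin.
- by rewrite mule_ge0// lee_fin.
Qed.

(** The condition [F 0 = 0] removes the point at which [z^-1] is a default value. *)
Lemma planar_inv F : measP F -> (forall z, (0 <= F z)%E) -> F 0 = 0%E ->
  planar F = planar (fun z => F (z^-1)%R * ((nsq z)^-1 ^+ 2)%R%:E)%E.
Proof.
move=> mF F0 F00.
pose G z := (F z * (nsq z)%:E)%E.
have mn : measurable_fun setT (fun p : mR * mR => nsq (toC p)).
  by apply: measurable_nsq; exact: measC_toC.
transitivity (haar G).
  apply: eq_integral => p _; rewrite /G; set z := toC p.
  have [->|z0] := eqVneq z 0; first by rewrite F00 !mul0e.
  by rewrite -muleA -EFinM /W divff ?nsq_eq0// mule1.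
rewrite -haar_inv; last 2 first.
- exact: measP_mul.
- by move=> z; rewrite mule_ge0// lee_fin nsq_ge0.
apply: eq_integral => p _; rewrite /G; set z := toC p.
by rewrite -muleA -EFinM /W nsqV expr2.
Qed.

(** Change of variables for a disc automorphism composed with a rotation. *)
Lemma planar_mobius (a s : R) (om : R[i]) (H : R[i] -> \bar R) :
  0 < a < 1 -> nsq om = 1 -> measP H -> (forall z, (0 <= H z)%E) ->
  (planar (fun z => H z *
     (nsq (conjc om * z - a%:C%C) < s * nsq (1 - a%:C%C * (conjc om * z)))%R%:R%:E)
   = planar (fun w => H (om * ((w + a%:C%C) / (1 + a%:C%C * w)))%R *
      (((1 - a ^+ 2) ^+ 2 * (nsq (1 + a%:C%C * w))^-1 ^+ 2)%R%:E *
        (nsq w < s)%R%:R%:E)))%E.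
Proof.
move=> /andP[a0 a1] om1 mH H0.
set ac := a%:C%C; set h := 1 - a ^+ 2.
have h0 : 0 < h by rewrite /h subr_gt0 expr_lt1// ltW.
have ac0 : ac != 0 by rewrite /ac eq_complex /= eqxx andbT gt_eqF.
have omc : conjc om * om = 1.
  by rewrite conjcM_nsq om1; apply/eqP; rewrite eq_complex /= !eqxx.
have mind (f g : mR * mR -> R[i]) : measC f -> measC g ->
    measurable_fun setT (fun p => ((nsq (f p) < s * nsq (g p))%R%:R : R)).
  move=> mf mg; apply: measurable_bool_indicator; apply: measurable_fun_ltr.
    exact: measurable_nsq.
  by apply: measurable_funM => //; exact: measurable_nsq.
have mz := @measC_toC R.
have mcz c : measC (fun p : mR * mR => c * toC p).
  by apply: measCM => //; exact: measC_cst.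
pose G z := (H (om * z)%R *
  (nsq (z - ac) < s * nsq (1 - ac * z))%R%:R%:E)%E.
have mG : measP G.
  apply: emeasurable_funM; first exact: (measurable_compC mH).
  apply/measurable_EFinP; apply: mind.
    by apply: measCD => //; exact: measC_cst.
  by apply: measCD; [exact: measC_cst|exact: measCN].
have G0 z : (0 <= G z)%E by rewrite mule_ge0// lee_fin ler0n.
transitivity (planar G).
  rewrite -[LHS](@planar_affine 0 om)//; last 3 first.
  - apply: emeasurable_funM => //.
    apply/measurable_EFinP; apply: mind.
      by apply: measCD => //; exact: measC_cst.
    by apply: measCD; [exact: measC_cst|apply: measCN; apply: measCM => //; exact: measC_cst].
  - by move=> z; rewrite mule_ge0// lee_fin ler0n.
  - by rewrite -nsq_gt0 om1.
  rewrite om1 mul1e; apply: eq_integral => p _; rewrite add0r /G.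
  by rewrite mulrA omc mul1r.
(* The automorphism is [v -> 1 / a - (h / a) / v] after [w -> 1 + a w]. *)
pose l : R[i] := - ((h / a)%:C%C).
have l0 : l != 0.
  by rewrite oppr_eq0 eq_complex /= eqxx andbT mulf_neq0// ?invr_eq0 gt_eqF.
have nl : nsq l = (h / a) ^+ 2 by rewrite nsqN nsq_real.
rewrite -(@planar_affine ac^-1 l G)//.
have mF : measP (fun v => G (ac^-1 + l * v)).
  by apply: (measP_comp (g := fun v => ac^-1 + l * v)) => //; exact: measC_affine.
rewrite (@planar_inv (fun v => G (ac^-1 + l * v)))//; last first.
  by rewrite /G mulr0 addr0 mulfV// subrr nsq0 mulr0 ltNge nsq_ge0 mule0.
rewrite -(@planar_affine 1 ac); last 3 first.
- apply: emeasurable_funM.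
    apply: (@measP_comp (fun v => G (ac^-1 + l * v)) (fun v => v^-1)) => //.
    exact: measCV.
  apply/measurable_EFinP; apply: measurable_funX; apply: measurable_fun_inv.
    by move=> p; exact: nsq_ge0.
  exact: measurable_nsq.
- by move=> z; rewrite mule_ge0// lee_fin sqr_ge0.
- by [].
rewrite muleA -EFinM nl nsq_real -exprMn mulfVK ?gt_eqF// -planarZl; last 3 first.
- apply: emeasurable_funM.
    apply: (@measP_comp (fun v => G (ac^-1 + l * v)) (fun v => (1 + ac * v)^-1)) => //.
    by apply: measCV; exact: measC_affine.
  apply/measurable_EFinP; apply: measurable_funX; apply: measurable_fun_inv.
    by move=> p; exact: nsq_ge0.
  by apply: measurable_nsq; exact: measC_affine.
- by move=> z; rewrite mule_ge0// lee_fin sqr_ge0.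
- by rewrite lee_fin sqr_ge0.
apply: eq_integral => p _; set w := toC p; set D := 1 + ac * w.
have [D0|D0] := eqVneq D 0.
  by rewrite D0 nsq0 !invr0 expr0n /= !(mulr0, mule0, mul0e).
have e1 : ac^-1 + l * D^-1 = (w + ac) / D.
  have -> : l = - ((1 - ac ^+ 2) / ac).
    rewrite /l /h; apply/eqP; rewrite -subr_eq0 opprK; apply/eqP.
    by rewrite rmorphM /= fmorphV rmorphB /= rmorphXn rmorph1 addNr.
  by rewrite /D; field; rewrite ac0 -/D ?D0.
have e2 : (w + ac) / D - ac = w * (h%:C%C / D).
  by rewrite /h rmorphB /= rmorphXn rmorph1 /D; field; rewrite -/D.
have e3 : 1 - ac * ((w + ac) / D) = h%:C%C / D.
  by rewrite /h rmorphB /= rmorphXn rmorph1 /D; field; rewrite -/D.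
rewrite e1 /G e2 e3 nsqM [nsq (_ / D)]nsqM nsq_real nsqV ltr_pM2r; last first.
  by rewrite mulr_gt0 ?exprn_gt0// invr_gt0 nsq_gt0.
have ac4 (k x i c : \bar R) : (k * (x * i * c) = x * (k * c * i))%E.
  by rewrite -(muleA x) (muleCA k) (muleC i) (muleA k).
by rewrite ac4 [X in _ = (_ * (X * _))%E]EFinM.
Qed.

End plane_change_of_variables.

(** * Radial integrals *)

Section radial.
Variable R : realType.
Local Notation mR := (measurableTypeR R).
Local Notation leb := (@lebesgue_measure R).
Local Notation leb2 := (@lebesgue_plane R).

Let mnsq : measurable_fun setT (fun p : mR * mR => nsq (toC p)).
Proof. by apply: measurable_nsq; exact: measC_toC. Qed.

(** The area of the disc [|z|^2 <= t] is [c t], by scaling. *)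
Let A (t : R) : set (mR * mR) := [set p | nsq (toC p) <= t].

Let mA t : measurable (A t).
Proof.
rewrite (_ : A t = (fun p : mR * mR => nsq (toC p)) @^-1` `]-oo, t]).
  by rewrite -[X in measurable X]setTI; apply: mnsq => //; exact: measurable_itv.
by apply/seteqP; split => p; rewrite /A /= in_itv.
Qed.

Let intA t : (\int[leb2]_p (\1_(A t) p)%:E = leb2 (A t))%E.
Proof. by rewrite integral_indic// setIT. Qed.

Let planarA t : leb2 (A t) = planar (fun z => (nsq z <= t)%R%:R%:E).
Proof.
rewrite /planar -intA.
apply: eq_integral => p _; rewrite indicE.
by have -> : (p \in A t) = (nsq (toC p) <= t) by apply/idP/idP; rewrite inE.
Qed.

Let measA t : measP (fun z : R[i] => (nsq z <= t)%R%:R%:E).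
Proof.
apply/measurable_EFinP; apply: measurable_bool_indicator.
exact: measurable_fun_ler.
Qed.

Let scaleA t : 0 < t -> leb2 (A t) = (t%:E * leb2 (A 1))%E.
Proof.
move=> t0; rewrite !planarA.
have l0 : (Num.sqrt t)%:C%C != 0.
  by rewrite eq_complex /= eqxx andbT gt_eqF// sqrtr_gt0.
rewrite -(@planar_affine R 0 _ _ (measA t) (fun z => ltac:(by rewrite lee_fin ler0n)) l0).
have tE : Num.sqrt t ^+ 2 = t by rewrite sqr_sqrtr// ltW.
rewrite nsq_real tE; congr (_ * _)%E.
apply: eq_integral => p _; rewrite add0r nsqM nsq_real tE.
by rewrite -[X in (_ <= X)%R]mulr1 ler_pM2l.
Qed.

Let leb2_rect (a b : R) : a < b ->
  leb2 (`[a, b]%classic `*` `[a, b]%classic) = ((b - a) ^+ 2)%:E.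
Proof.
move=> ab; have I : leb `[a, b]%classic = (b - a)%:E.
  by rewrite lebesgue_measure_itv/= lte_fin ab -EFinD.
rewrite /lebesgue_plane product_measure1E; [|exact: measurable_itv..].
by rewrite [X in (X * X)%E]I -EFinM expr2.
Qed.

Let leb2_le B C : measurable B -> measurable C -> B `<=` C ->
  (leb2 B <= leb2 C)%E.
Proof. by move=> mB mC; apply: le_measure => //; exact: mem_set. Qed.

Let A1_fin : (leb2 (A 1) < +oo)%E.
Proof.
apply: (@le_lt_trans _ _ (leb2 (`[(-1 : R), 1]%classic `*` `[(-1 : R), 1]%classic))).
  apply: leb2_le; first exact: mA.
    by apply: measurableX; exact: measurable_itv.
  have sq1 (t : R) : t ^+ 2 <= 1 -> -1 <= t <= 1.
    move=> h; rewrite -ler_norml -(@ler_pXn2r _ 2)// ?nnegrE//.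
    by rewrite real_normK ?num_real// expr1n.
  move=> [x y]; rewrite /A /nsq /= => h; rewrite !in_itv/=.
  by split; apply: sq1; apply: le_trans h; rewrite ?lerDl ?lerDr sqr_ge0.
by rewrite leb2_rect ?ltry// gtrN.
Qed.

Let A1_gt0 : (0 < leb2 (A 1))%E.
Proof.
apply: (@lt_le_trans _ _ (leb2 (`[(0 : R), 1 / 2]%classic `*` `[(0 : R), 1 / 2]%classic))).
  by rewrite leb2_rect ?lte_fin; lra.
apply: leb2_le; [|exact: mA|].
  by apply: measurableX; exact: measurable_itv.
move=> [x y]; rewrite /A /nsq /= !in_itv/= => -[/andP[x0 x1] /andP[y0 y1]].
nra.
Qed.

Let c : R := fine (leb2 (A 1)).
Let cE : leb2 (A 1) = c%:E.
Proof. by rewrite fineK// ge0_fin_numE// A1_fin. Qed.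
Let c_gt0 : 0 < c.
Proof. by rewrite -lte_fin -cE A1_gt0. Qed.

Let NE t : leb2 (A t) = (c * Num.max t 0)%:E.
Proof.
have [t0|t0|->] := ltgtP t 0.
- rewrite mulr0 (_ : A t = set0) ?measure0//.
  apply/seteqP; split => // p; rewrite /A /= leNgt => /negP; apply.
  by rewrite (lt_le_trans t0)// nsq_ge0.
- by rewrite scaleA// cE -EFinM mulrC.
- rewrite mulr0; apply/eqP; rewrite eq_le measure_ge0 andbT.
  apply: (@le_trans _ _ (leb2 ([set (0 : R)] `*` [set (0 : R)]))); last first.
    rewrite /lebesgue_plane product_measure1E; [|exact: measurable_set1..].
    by rewrite [X in (X * _)%E]lebesgue_measure_set1 mul0e.
  apply: leb2_le; first exact: mA.
    by apply: measurableX; exact: measurable_set1.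
  move=> [x y]; rewrite /A /=.
  have : nsq (toC (x, y)) = 0 -> x = 0 /\ y = 0.
    by move=> /eqP; rewrite nsq_eq0 eq_complex /= => /andP[/eqP -> /eqP ->].
  by move=> h xy; apply: h; apply/eqP; rewrite eq_le xy nsq_ge0.
Qed.

(** Hence the image [nu] of area under [|z|^2], divided by [c], is Lebesgue measure on
    the half-line [D]. *)
Let D : set mR := `[(0 : R), +oo[%classic.
Let D' : set mR := `]-oo, (0 : R)[%classic.
Let mD : measurable D. Proof. exact: measurable_itv. Qed.
Let mD' : measurable D'. Proof. exact: measurable_itv. Qed.

Let nsqm (p : mR * mR) : mR := nsq (toC p).
Let mnsqm : measurable_fun setT nsqm. Proof. exact: mnsq. Qed.
Let cV_ge0 : 0 <= c^-1. Proof. by rewrite invr_ge0 ltW. Qed.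

Let nu : {measure set mR -> \bar R} := @mscale _ _ R (NngNum cV_ge0)
  (measure_function_pushforward__canonical__measure_function_Measure leb2 mnsqm).

Let nuE B : nu B = (c^-1%:E * leb2 (nsqm @^-1` B))%E.
Proof. by []. Qed.

Let nu_oc a b : a < b ->
  nu `]a, b]%classic = (Num.max b 0 - Num.max a 0)%:E.
Proof.
move=> ab; rewrite nuE.
rewrite (_ : _ @^-1` _ = A b `\` A a); last first.
  apply/seteqP; split => p; rewrite /A /= in_itv/=.
    by move=> /andP[h1 h2]; split => //; apply/negP; rewrite -ltNge.
  by move=> [h1 /negP]; rewrite -ltNge h1 => ->.
have fb : (leb2 (A b) < +oo)%E by rewrite NE ltry.
have -> : leb2 (A b `\` A a) = (leb2 (A b) - leb2 (A b `&` A a))%E.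
  exact: measureD (mA b) (mA a) fb.
rewrite (_ : A b `&` A a = A a); last first.
  apply/seteqP; split => p; rewrite /A /=; first by case.
  by move=> h; split => //; rewrite (le_trans h)// ltW.
by rewrite !NE -EFinB -EFinM -mulrBr mulrA mulVf ?mul1r// gt_eqF.
Qed.

Let lebE B : measurable B -> leb B = measure_add nu (mrestr leb mD') B.
Proof.
move=> mB; apply: lebesgue_measure_unique => // _ [[a b] _ <-].
transitivity (nu `]a, b]%classic + mrestr leb mD' `]a, b]%classic)%E; last first.
  by apply/esym; exact: measure_addE.
have [ba|ab] := leP b a.
  by rewrite set_itv_ge ?bnd_simp -?leNgt// !measure0 adde0.
rewrite nu_oc// /mrestr.
have -> : leb `]a, b]%classic = (b - a)%:E.
  by rewrite lebesgue_measure_itv/= lte_fin ab -EFinB.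
have [b0|b0] := ltP b 0.
  rewrite (_ : _ `&` _ = `]a, b]%classic); last first.
    apply/seteqP; split => x; rewrite /D' /= !in_itv/=; first by case.
    by move=> /andP[h1 h2]; split; [rewrite h1|rewrite (le_lt_trans h2)].
  rewrite lebesgue_measure_itv/= lte_fin ab -!EFinB -EFinD; congr EFin.
  by rewrite !max_r ?ltW ?(lt_trans ab)// subrr add0r.
rewrite (_ : _ `&` _ = `]a, (0:R)[%classic); last first.
  apply/seteqP; split => x; rewrite /D' /= !in_itv/=.
    by move=> [/andP[-> _] ->].
  by move=> /andP[h1 h2]; split => //; rewrite h1 (le_trans (ltW h2)).
rewrite lebesgue_measure_itv/= lte_fin.
case: ifPn => a0.
  by rewrite -!EFinB -EFinD; congr EFin; rewrite max_r ?ltW//; ring.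
by rewrite adde0 max_l// leNgt.
Qed.

Let radial_c (f : mR -> \bar R) : measurable_fun setT f -> (forall x, (0 <= f x)%E) ->
  (c%:E * \int[leb]_(s in D) f s = \int[leb2]_p f (nsq (toC p)))%E.
Proof.
move=> mf f0.
transitivity (c%:E * \int[nu]_(s in D) f s)%E.
  congr (_ * _)%E; apply: eq_measure_integral => B mB BD.
  transitivity (nu B + mrestr leb mD' B)%E.
    by apply: (etrans (lebE mB)); exact: measure_addE.
  rewrite /mrestr /= (_ : B `&` D' = set0) ?measure0 ?adde0//.
  apply/seteqP; split => // x [/BD]; rewrite /D /D' /= !in_itv/= andbT => h1.
  by rewrite ltNge h1.
rewrite ge0_integral_mscale//=; last exact: measurable_funTS.
rewrite muleA -EFinM mulfV ?gt_eqF// mul1e.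
rewrite ge0_integral_pushforward//; last exact: measurable_funTS.
rewrite (_ : _ @^-1` D = setT)//.
by apply/seteqP; split => // p _; rewrite /D /= in_itv/= andbT nsq_ge0.
Qed.

(** The constant is read off from the Gaussian integral. *)
Let c_pi : c = pi.
Proof.
have mexp : measurable_fun setT (fun s : mR => (expR (- s))%:E).
  apply/measurable_EFinP; apply: continuous_measurable_fun.
  by move=> x; apply: continuous_comp; [exact: opp_continuous|exact: continuous_expR].
have exp0 (s : mR) : (0 <= (expR (- s))%:E)%E by rewrite lee_fin expR_ge0.
have := radial_c mexp exp0.
rewrite (_ : \int[leb]_(s in D) (expR (- s))%:E = 1)%E; last first.
  rewrite -(@integral_exponential_pdf R 1 ltr01) [RHS]integral_mkcond.
  rewrite [LHS]integral_mkcond; apply: eq_integral => x _.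
  rewrite !patchE in_setT; case: ifPn => xD.
    rewrite exponential_pdfE ?mul1r ?mulN1r//.
    by move: xD; rewrite inE /D /= in_itv/= andbT.
  rewrite lt0_exponential_pdf//.
  by move: xD; rewrite notin_setE /D /= in_itv/= andbT => /negP; rewrite -ltNge.
rewrite mule1 => cI; apply: EFin_inj; rewrite cI.
have mE : measurable_fun setT (fun p : mR * mR => (expR (- nsq (toC p)))%:E).
  exact: (measurableT_comp mexp mnsq).
rewrite integral_plane_xy//.
transitivity (\int[leb]_x ((Num.sqrt pi)%:E * (gauss_fun x)%:E))%E.
  apply: eq_integral => x _.
  rewrite -integralT_gauss muleC -ge0_integralZl//; last 3 first.
  - by apply/measurable_EFinP; exact: measurable_gauss_fun.
  - by move=> y _; rewrite lee_fin gauss_fun_ge0.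
  - by rewrite lee_fin gauss_fun_ge0.
  by apply: eq_integral => y _; rewrite -EFinM /gauss_fun -expRD /nsq /= opprD.
rewrite ge0_integralZl; last 4 first.
- exact: measurableT.
- by apply/measurable_EFinP; exact: measurable_gauss_fun.
- by move=> y _; rewrite lee_fin gauss_fun_ge0.
- by rewrite lee_fin sqrtr_ge0.
by rewrite integralT_gauss -EFinM -expr2 sqr_sqrtr// pi_ge0.
Qed.

Lemma dA_planar (F : R[i] -> \bar R) : measP F -> (forall z, (0 <= F z)%E) ->
  (\int[dA R]_p F (toC p) = (pi^-1)%:E * planar F)%E.
Proof. by move=> mF F0; rewrite /dA ge0_integral_mscale. Qed.

(** Radial integrals against normalized area: [|z|^2] is uniformly distributed. *)
Lemma integral_radial (f : mR -> \bar R) :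
  measurable_fun setT f -> (forall x, (0 <= f x)%E) ->
  (\int[dA R]_p f (nsq (toC p)) = \int[leb]_(s in `[(0%R : R), +oo[%classic) f s)%E.
Proof.
move=> mf f0; rewrite (dA_planar (F := fun z => f (nsq z)))//; last first.
  exact: (measurableT_comp mf mnsq).
by rewrite /planar -radial_c// muleA -EFinM c_pi mulVf ?mul1e// gt_eqF// pi_gt0.
Qed.

End radial.

(** * Integrals over discs *)

Section disc_average.
Variable R : realType.
Local Notation mR := (measurableTypeR R).
Local Notation leb := (@lebesgue_measure R).
Implicit Types (F G : R[i] -> R) (t : R).

(** The disc of squared radius [t]; it is empty when [t <= 0]. *)
Definition sdisc t : set (mR * mR) := [set p | nsq (toC p) < t].

Lemma measurable_sdisc t : measurable (sdisc t).
Proof.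
rewrite (_ : sdisc t = (fun p : mR * mR => nsq (toC p)) @^-1` `]-oo, t[).
  have m : measurable_fun setT (fun p : mR * mR => nsq (toC p)).
    by apply: measurable_nsq; exact: measC_toC.
  by rewrite -[X in measurable X]setTI; apply: m => //; exact: measurable_itv.
by apply/seteqP; split => p; rewrite /sdisc /= in_itv.
Qed.
Hint Resolve measurable_sdisc : core.

Lemma dA_sdisc t : 0 <= t -> dA R (sdisc t) = t%:E.
Proof.
move=> t0.
have mI : measurable_fun setT (fun s : mR => (s < t)%R%:R%:E : \bar R).
  by apply/measurable_EFinP; apply: measurable_bool_indicator; exact: measurable_fun_ltr.
transitivity (\int[dA R]_p (\1_(sdisc t) p)%:E)%E.
  by rewrite integral_indic// setIT.
transitivity (\int[dA R]_p (nsq (toC p) < t)%R%:R%:E)%E.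
  apply: eq_integral => p _; rewrite indicE.
  by have -> : (p \in sdisc t) = (nsq (toC p) < t) by apply/idP/idP; rewrite inE.
rewrite (@integral_radial R (fun s => (s < t)%R%:R%:E))//.
transitivity (\int[leb]_(s in `[(0%R : R), +oo[) (\1_(`[(0%R : R), t[%classic : set mR) s)%:E)%E.
  apply: eq_integral => s; rewrite inE /= in_itv/= andbT => s0.
  rewrite indicE; have -> // : (s \in `[(0%R : R), t[%classic) = (s < t)%R.
  by apply/idP/idP; rewrite inE /= in_itv/= s0.
rewrite integral_indic; [|exact: measurable_itv..].
rewrite setIidl; last by move=> s /=; rewrite !in_itv/= => /andP[->].
transitivity (leb `[(0%R : R), t[%classic) => //.
rewrite lebesgue_measure_itv/= lte_fin; case: ltP => // [_|t0'].
  by rewrite -EFinB subr0.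
by congr EFin; apply/eqP; rewrite eq_le t0 t0'.
Qed.

(** Functions that are measurable, and bounded on the disc of squared radius [t]. *)
Definition tame t F := measurable_fun setT (fun p : mR * mR => F (toC p)) /\
  exists M, forall z, nsq z < t -> `|F z| <= M.

Lemma tame_integrable t F : tame t F ->
  (dA R).-integrable (sdisc t) (EFin \o (fun p => F (toC p))).
Proof.
move=> [mF [M FM]]; apply: measurable_bounded_integrable.
- exact: measurable_sdisc.
- have [t0|t0] := leP 0 t; first by rewrite dA_sdisc ?ltry.
  rewrite (_ : sdisc t = set0) ?measure0//.
  apply/seteqP; split => // p; rewrite /sdisc /= => h.
  by have := lt_trans h t0; rewrite ltNge nsq_ge0.
- exact: measurable_funTS.
- exists M; split; first exact: num_real.
  by move=> N MN p; rewrite /sdisc /= => h; rewrite (le_trans (FM _ h))// ltW.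
Qed.

Lemma tame_cst t c : tame t (fun=> c).
Proof. by split => //; exists `|c|. Qed.

Lemma tameD t F G : tame t F -> tame t G -> tame t (fun z => F z + G z).
Proof.
move=> [mF [M FM]] [mG [N GN]]; split; first exact: measurable_funD.
by exists (M + N) => z zt; rewrite (le_trans (ler_normD _ _))// lerD ?FM ?GN.
Qed.

Lemma tameM t F G : tame t F -> tame t G -> tame t (fun z => F z * G z).
Proof.
move=> [mF [M FM]] [mG [N GN]]; split; first exact: measurable_funM.
by exists (M * N) => z zt; rewrite normrM ler_pM ?FM ?GN.
Qed.

Lemma tameN t F : tame t F -> tame t (fun z => - F z).
Proof.
move=> [mF [M FM]]; split; first exact: measurableT_comp.
by exists M => z zt; rewrite normrN FM.
Qed.

Lemma tameB t F G : tame t F -> tame t G -> tame t (fun z => F z - G z).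
Proof. by move=> tF tG; apply: tameD => //; exact: tameN. Qed.

Lemma tameX t F n : tame t F -> tame t (fun z => F z ^+ n).
Proof.
move=> tF; elim: n => [|n IH]; first by under eq_fun do rewrite expr0; exact: tame_cst.
by under eq_fun do rewrite exprS; exact: tameM.
Qed.

Lemma tame_sum t (J : Type) (s : seq J) (F : J -> R[i] -> R) :
  (forall j, tame t (F j)) -> tame t (fun z => \sum_(j <- s) F j z).
Proof.
move=> tF; elim: s => [|j s IH].
  by under eq_fun do rewrite big_nil; exact: tame_cst.
by under eq_fun do rewrite big_cons; exact: tameD.
Qed.

Lemma tame_nsq t : tame t (@nsq R).
Proof.
split; first by apply: measurable_nsq; exact: measC_toC.
by exists t => z zt; rewrite ger0_norm ?nsq_ge0// ltW.
Qed.

Lemma tame_cmod t : tame t (@cmod R).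
Proof.
split; first by apply: measurable_cmod; exact: measC_toC.
exists (Num.sqrt t) => z zt; rewrite ger0_norm ?cmod_ge0// cmodE.
by rewrite ler_wsqrtr// ltW.
Qed.

Lemma tame_le t F G : measurable_fun setT (fun p : mR * mR => F (toC p)) ->
  tame t G -> (forall z, nsq z < t -> `|F z| <= G z) -> tame t F.
Proof.
move=> mF [_ [M GM]] FG; split => //; exists M => z zt.
by rewrite (le_trans (FG _ zt))// (le_trans (ler_norm _))// GM.
Qed.

Lemma tame_cmod_horner t (P : {poly R[i]}) : tame t (fun z => cmod P.[z]).
Proof.
have mP (Q : {poly R[i]}) : measurable_fun setT (fun p : mR * mR => cmod Q.[toC p]).
  by apply: measurable_cmod; apply: measC_horner; exact: measC_toC.
elim/poly_ind: P => [|P c IH].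
  by under eq_fun do rewrite horner0; exact: tame_cst.
apply: (@tame_le t _ (fun z => cmod P.[z] * cmod z + cmod c)) => //.
  by apply: tameD; [apply: tameM => //; exact: tame_cmod|exact: tame_cst].
move=> z zt; rewrite ger0_norm ?cmod_ge0// hornerMXaddC.
by rewrite (le_trans (cmodD _ _))// cmodM.
Qed.

Lemma tame_nsq_horner t (P : {poly R[i]}) : tame t (fun z => nsq P.[z]).
Proof.
under eq_fun do rewrite -cmod_sqr; apply: tameX; exact: tame_cmod_horner.
Qed.

Lemma tame_radial t (f : mR -> R) M : measurable_fun setT f ->
  (forall s, 0 <= s < t -> `|f s| <= M) -> tame t (fun z => f (nsq z)).
Proof.
move=> mf fM; split.
  by apply: (measurableT_comp mf); apply: measurable_nsq; exact: measC_toC.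
by exists M => z zt; apply: fM; rewrite nsq_ge0.
Qed.

(** Integral over the disc of squared radius [t] for the normalized area; the mass of
    the disc, which is [t], is not divided out. *)
Definition avg t F : R := (\int[dA R]_(p in sdisc t) F (toC p))%R.

Lemma avgE t F : tame t F ->
  (avg t F)%:E = (\int[dA R]_(p in sdisc t) (F (toC p))%:E)%E.
Proof.
move=> tF; rewrite /avg /Rintegral fineK//.
by have := tame_integrable tF; exact: integrable_fin_num.
Qed.

Lemma avgD t F G : tame t F -> tame t G ->
  avg t (fun z => F z + G z) = avg t F + avg t G.
Proof. by move=> tF tG; rewrite /avg RintegralD//; exact: tame_integrable. Qed.

Lemma avgZ t F c : tame t F -> avg t (fun z => c * F z) = c * avg t F.
Proof. by move=> tF; rewrite /avg RintegralZl//; exact: tame_integrable. Qed.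

Lemma avgB t F G : tame t F -> tame t G ->
  avg t (fun z => F z - G z) = avg t F - avg t G.
Proof. by move=> tF tG; rewrite /avg RintegralB//; exact: tame_integrable. Qed.

Lemma le_avg t F G : tame t F -> tame t G ->
  (forall z, nsq z < t -> F z <= G z) -> avg t F <= avg t G.
Proof.
move=> tF tG FG; rewrite /avg le_Rintegral//; [exact: tame_integrable..|].
by move=> p pt; exact: FG.
Qed.

Lemma eq_avg t F G : (forall z, nsq z < t -> F z = G z) -> avg t F = avg t G.
Proof. by move=> FG; rewrite /avg; apply: eq_Rintegral => p; rewrite inE; exact: FG. Qed.

Lemma avg_ge0 t F : (forall z, nsq z < t -> 0 <= F z) -> 0 <= avg t F.
Proof. by move=> F0; apply: Rintegral_ge0 => p pt; exact: F0. Qed.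

Lemma avg_cst t c : 0 <= t -> avg t (fun=> c) = c * t.
Proof. by move=> t0; rewrite /avg Rintegral_cst// dA_sdisc. Qed.

Lemma avg_sum t (J : Type) (s : seq J) (F : J -> R[i] -> R) :
  (forall j, tame t (F j)) ->
  avg t (fun z => \sum_(j <- s) F j z) = \sum_(j <- s) avg t (F j).
Proof.
move=> tF; elim: s => [|j s IH].
  rewrite big_nil -[RHS](mul0r (avg t (fun=> 0))) -avgZ; last exact: tame_cst.
  by apply: eq_avg => z _; rewrite big_nil mul0r.
rewrite big_cons -IH -avgD//; last exact: tame_sum.
by apply: eq_avg => z _; rewrite big_cons.
Qed.

Let avg_planar t F : tame t F -> (forall z, nsq z < t -> 0 <= F z) ->
  (avg t F)%:E = ((pi^-1)%:E * planar (fun z => (F z * (nsq z < t)%R%:R)%:E))%E.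
Proof.
move=> tF F0; rewrite avgE// integral_mkcond -dA_planar.
- apply: eq_integral => p _; rewrite patchE.
  have -> : (p \in sdisc t) = (nsq (toC p) < t) by apply/idP/idP; rewrite inE.
  by case: ifP => _; rewrite ?mulr1 ?mulr0.
- apply/measurable_EFinP; apply: measurable_funM; first by case: tF.
  apply: measurable_bool_indicator; apply: measurable_fun_ltr => //.
  by apply: measurable_nsq; exact: measC_toC.
- move=> z; rewrite lee_fin; case: ltP => zt; last by rewrite mulr0.
  by rewrite mulr1 F0.
Qed.

Lemma tame_rot t F om : nsq om = 1 -> tame t F -> tame t (fun z => F (om * z)).
Proof.
move=> om1 [mF [M FM]]; split.
  apply/measurable_EFinP.
  apply: (@measurable_compC R _ _ (fun z => (F z)%:E) (fun p => om * toC p)).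
    exact/measurable_EFinP.
  by apply: measCM; [exact: measC_cst|exact: measC_toC].
by exists M => z zt; apply: FM; rewrite nsqM om1 mul1r.
Qed.

Lemma avg_rot t F om : nsq om = 1 -> tame t F ->
  avg t (fun z => F (om * z)) = avg t F.
Proof.
move=> om1 tF; have [t0|t0] := leP 0 t; last first.
  have e G : avg t G = 0.
    rewrite -[RHS](mul0r (avg t (fun=> 0))) -avgZ; last exact: tame_cst.
    by apply: eq_avg => z zt; have := lt_trans zt t0; rewrite ltNge nsq_ge0.
  by rewrite !e.
have pos G : tame t G -> (forall z, nsq z < t -> 0 <= G z) ->
    avg t (fun z => G (om * z)) = avg t G.
  move=> tG G0; apply: EFin_inj; rewrite !avg_planar//; last 2 first.
  - exact: tame_rot.
  - by move=> z zt; apply: G0; rewrite nsqM om1 mul1r.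
  congr (_ * _)%E.
  rewrite -[RHS](@planar_affine R 0 om).
  - rewrite om1 mul1e; apply: eq_integral => p _.
    by rewrite add0r nsqM om1 mul1r.
  - apply/measurable_EFinP; apply: measurable_funM; first by case: tG.
    apply: measurable_bool_indicator; apply: measurable_fun_ltr => //.
    by apply: measurable_nsq; exact: measC_toC.
  - move=> z; rewrite lee_fin; case: ltP => zt; last by rewrite mulr0.
    by rewrite mulr1 G0.
  - by rewrite -nsq_gt0 om1.
case: (tF) => _ [M FM].
(* Adding a bound makes the function nonnegative on the disc. *)
have tFM : tame t (fun z => F z + M) by apply: tameD => //; exact: tame_cst.
have tc : tame t (fun=> M) by exact: tame_cst.
have FM0 z : nsq z < t -> 0 <= F z + M.
  by move=> zt; rewrite -lerBlDr sub0r; have := FM _ zt; rewrite ler_norml => /andP[].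
apply: (addIr (avg t (fun=> M))).
rewrite -(avgD (tame_rot om1 tF) tc) -(avgD tF tc).
exact: pos tFM FM0.
Qed.

End disc_average.

(** * Angular modes and Parseval's identity *)

Section modes.
Variable R : realType.
Local Notation mR := (measurableTypeR R).
Local Notation leb := (@lebesgue_measure R).
Local Notation Re := (@complex.Re R).
Implicit Types (t : R).

Lemma rotation_sign d : (0 < d)%N -> exists2 om : R[i], nsq om = 1 & om ^+ d = -1.
Proof.
move=> d0; exists (d.-root (-1)); last by rewrite rootCK.
apply/eqP; rewrite -(@pexpr_eq1 _ _ d)// ?nsq_ge0//.
by rewrite -nsqX rootCK// nsqN nsq1.
Qed.

Lemma tame_mode t (f : R[i] -> R) c k l : tame t f ->
  tame t (fun z => f z * Re (c * conjc z ^+ k * z ^+ l)).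
Proof.
move=> tf; apply: tameM => //.
apply: (@tame_le _ t _ (fun z => cmod c * cmod z ^+ k * cmod z ^+ l)).
- have mz := @measC_toC R.
  apply: (_ : measC (fun p : mR * mR => c * conjc (toC p) ^+ k * toC p ^+ l)).1.
  apply: measCM; last exact: measCX.
  by apply: measCM; [exact: measC_cst|apply: measCX; exact: measC_conj].
- apply: tameM; [apply: tameM; first exact: tame_cst|];
    by apply: tameX; exact: tame_cmod.
move=> z zt.
apply: le_trans (norm_Re_le_cmod _) _.
by rewrite !cmodM !cmodX [cmod (conjc z)]cmodE nsq_conj -cmodE.
Qed.

(** Distinct angular modes are orthogonal: the rotation that changes the sign of
    the mode [l - k] leaves the integral unchanged. *)
Lemma avg_mode0 t (f : R -> R) c k l : k != l -> tame t (fun z => f (nsq z)) ->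
  avg t (fun z => f (nsq z) * Re (c * conjc z ^+ k * z ^+ l)) = 0.
Proof.
move=> kl tf; set F := fun z => _.
have tF : tame t F by exact: tame_mode.
suff [om om1 omF] : exists2 om, nsq om = 1 & forall z, F (om * z) = - F z.
  have : avg t F = - avg t F.
    rewrite -[LHS](avg_rot om1)// -mulN1r -avgZ//.
    by apply: eq_avg => z _; rewrite omF mulN1r.
  by lra.
have ReN (x : R[i]) : Re (- x) = - Re x by case: x.
have conjM (x y : R[i]) : conjc (x * y) = conjc x * conjc y by rewrite rmorphM.
have conjX (x : R[i]) n : conjc (x ^+ n) = conjc x ^+ n by rewrite rmorphXn.
wlog: / (k < l)%N.
  move=> H; have [kl'|lk|kl'] := ltngtP k l; [exact: H| |by rewrite kl' eqxx in kl].
  have [|om om1 omd] := @rotation_sign (k - l); first by rewrite subn_gt0.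
  exists om => // z; rewrite /F nsqM om1 mul1r -mulrN -ReN; congr (_ * Re _).
  have ek : conjc om ^+ k = - conjc om ^+ l.
    by rewrite -{1}(subnK (ltnW lk)) exprD -conjX omd rmorphN rmorph1 mulN1r.
  rewrite conjM !exprMn ek.
  have e : conjc om ^+ l * om ^+ l = 1.
    rewrite -exprMn conjcM_nsq om1; suff -> : (1%:C%C : R[i]) = 1 by rewrite expr1n.
    by apply/eqP; rewrite eq_complex /= !eqxx.
  transitivity (- (c * conjc z ^+ k * z ^+ l) * (conjc om ^+ l * om ^+ l)); last first.
    by rewrite e mulr1.
  by ring.
move=> kl'; have [|om om1 omd] := @rotation_sign (l - k); first by rewrite subn_gt0.
exists om => // z; rewrite /F nsqM om1 mul1r -mulrN -ReN; congr (_ * Re _).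
have el : om ^+ l = - om ^+ k by rewrite -(subnK (ltnW kl')) exprD omd mulN1r.
rewrite conjM !exprMn el.
have e : conjc om ^+ k * om ^+ k = 1.
  rewrite -exprMn conjcM_nsq om1; suff -> : (1%:C%C : R[i]) = 1 by rewrite expr1n.
  by apply/eqP; rewrite eq_complex /= !eqxx.
transitivity (- (c * conjc z ^+ k * z ^+ l) * (conjc om ^+ k * om ^+ k)); last first.
  by rewrite e mulr1.
by ring.
Qed.

Lemma tame_moment t (f : R[i] -> R) k : tame t f ->
  tame t (fun z => f z * nsq z ^+ k).
Proof. by move=> tf; apply: tameM => //; apply: tameX; exact: tame_nsq. Qed.

(** Parseval's identity with a radial weight. *)
Lemma avg_parseval t (f : R -> R) (P : {poly R[i]}) :
  tame t (fun z => f (nsq z)) ->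
  avg t (fun z => f (nsq z) * nsq P.[z]) =
  \sum_(k < size P) nsq P`_k * avg t (fun z => f (nsq z) * nsq z ^+ k).
Proof.
move=> tf.
have E z : f (nsq z) * nsq P.[z] = \sum_(k < size P) \sum_(l < size P)
    f (nsq z) * Re (conjc P`_k * P`_l * conjc z ^+ k * z ^+ l).
  transitivity (f (nsq z) * Re (conjc P.[z] * P.[z])).
    by rewrite conjcM_nsq.
  rewrite {1}horner_coef rmorph_sum horner_coef big_distrlr Re_sum mulr_sumr.
  apply: eq_bigr => k _; rewrite Re_sum mulr_sumr; apply: eq_bigr => l _.
  congr (_ * Re _); rewrite rmorphM rmorphXn /=; ring.
rewrite (eq_avg (fun z _ => E z)) avg_sum; last first.
  by move=> k; apply: tame_sum => l; exact: tame_mode.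
apply: eq_bigr => k _; rewrite avg_sum; last by move=> l; exact: tame_mode.
rewrite (bigD1 k)//= big1 ?addr0; last first.
  by move=> l lk; apply: avg_mode0 => //; rewrite eq_sym.
rewrite -avgZ; last exact: tame_moment.
apply: eq_avg => z _; rewrite -mulrA -exprMn !conjcM_nsq mulrCA; congr (_ * _).
by rewrite -rmorphXn -rmorphM.
Qed.

Lemma integral_itv_primitive (F f : R -> R) (a b : R) : a < b ->
  (forall x : R, a <= x <= b -> is_derive x 1 F (f x)) ->
  (forall x : R, a <= x <= b -> {for x, continuous f}) ->
  (\int[leb]_(x in `[a, b]) (f x)%:E = (F b - F a)%:E)%E.
Proof.
move=> ab dF cf.
have cF x : a <= x <= b -> F y @[y --> x] --> F x.
  move=> xab; have [dx _] := dF _ xab.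
  by apply: differentiable_continuous; exact/derivable1_diffP.
rewrite EFinB; apply: continuous_FTC2 => //.
- apply: continuous_in_subspaceT => x; rewrite inE /= in_itv/= => xab.
  exact: cf.
- split.
  + move=> x; rewrite in_itv => /andP[/= ax xb].
    have xab : a <= x <= b by rewrite (ltW ax) (ltW xb).
    by have [] := dF _ xab.
  + by apply: cvg_at_right_filter; apply: cF; rewrite lexx ltW.
  + by apply: cvg_at_left_filter; apply: cF; rewrite lexx ltW.
- move=> x; rewrite in_itv => /andP[/= ax xb].
  have xab : a <= x <= b by rewrite (ltW ax) (ltW xb).
  by have [_ <-] := dF _ xab; rewrite derive1E.
Qed.

(** Radial functions integrate over an annulus as functions of [|z|^2]. *)
Lemma avg_annulus t (F f : R -> R) (a b : R) :
  0 <= a -> a < b -> b <= t ->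
  measurable_fun setT (f : mR -> R) ->
  (forall x, a <= x <= b -> 0 <= f x) ->
  (forall x : R, a <= x <= b -> is_derive x 1 F (f x)) ->
  (forall x : R, a <= x <= b -> {for x, continuous f}) ->
  tame t (fun z => f (nsq z) * (a <= nsq z < b)%R%:R) /\
  avg t (fun z => f (nsq z) * (a <= nsq z < b)%R%:R) = F b - F a.
Proof.
move=> a0 ab bt mf f0 dF cf.
pose g (s : mR) : R := f s * (a <= s < b)%R%:R.
have mg : measurable_fun setT g.
  apply: measurable_funM => //; apply: measurable_bool_indicator.
  by apply: measurable_and; [exact: measurable_fun_ler|exact: measurable_fun_ltr].
have g0 s : 0 <= g s.
  rewrite /g; have [/andP[h1 h2]|_] := boolP (_ && _); last by rewrite mulr0.
  by rewrite mulr1 f0// h1 ltW.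
have [M gM] : exists M, forall s, `|g s| <= M.
  have : {within `[a, b], continuous f}.
    by apply: continuous_in_subspaceT => x; rewrite inE /= in_itv/= => xab; exact: cf.
  move=> /(EVT_max (ltW ab))[c _ cM]; exists (Num.max (f c) 0) => s.
  rewrite ger0_norm// /g; have [/andP[h1 h2]|_] := boolP (_ && _).
    by rewrite mulr1 le_max cM// in_itv/= h1 ltW.
  by rewrite mulr0 le_max lexx orbT.
have tg : tame t (fun z => g (nsq z)).
  by apply: (@tame_radial _ t g M) => // s _; exact: gM.
split=> //; apply: EFin_inj; rewrite -(integral_itv_primitive ab dF cf).
rewrite -[LHS]/((avg t (fun z => g (nsq z)))%:E) avgE//.
transitivity (\int[dA R]_p (g (nsq (toC p)))%:E)%E.
  rewrite integral_mkcond; apply: eq_integral => p _; rewrite patchE.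
  case: ifPn => //; rewrite notin_setE /sdisc /= => /negP; rewrite -leNgt => h.
  by rewrite /g [(_ < b)%R]ltNge (le_trans bt h) andbF mulr0.
rewrite (@integral_radial R (fun s => (g s)%:E)); last 2 first.
- exact/measurable_EFinP.
- by move=> s; rewrite lee_fin.
rewrite -integral_itv_bndo_bndc; last first.
  by apply/measurable_EFinP; exact: measurable_funTS.
rewrite [LHS]integral_mkcond [RHS]integral_mkcond; apply: eq_integral => s _.
rewrite !patchE /g.
have -> : (s \in `[(0%R : R), +oo[%classic) = (0 <= s).
  by apply/idP/idP; rewrite inE /= in_itv/= andbT.
have -> : (s \in `[a, b[%classic) = (a <= s < b).
  by apply/idP/idP; rewrite inE /= in_itv/=.
have [/andP[h1 _]|_] := boolP (a <= s < b); last by rewrite mulr0; case: ifP.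
by rewrite mulr1 (le_trans a0 h1).
Qed.

Lemma is_derive_monomial k (x : R) :
  is_derive x 1 (fun s => s ^+ k.+1 / k.+1%:R) (x ^+ k).
Proof.
have -> : (fun s : R => s ^+ k.+1 / k.+1%:R) = k.+1%:R^-1 \*: ((@id R) ^+ k.+1).
  by apply/funext => s; rewrite /= exprfctE mulrC.
have -> : x ^+ k = k.+1%:R^-1 *: ((k.+1%:R * x ^+ k) *: (1 : R)).
  by rewrite /GRing.scale /= mulr1 mulrA mulVf ?mul1r// pnatr_eq0.
by apply: is_deriveZ; exact: (@is_deriveX R R id k x 1 1 (is_derive_id x 1)).
Qed.

Lemma avg_annulus_monomial t k a b : 0 <= a -> a < b -> b <= t ->
  tame t (fun z => nsq z ^+ k * (a <= nsq z < b)%R%:R) /\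
  avg t (fun z => nsq z ^+ k * (a <= nsq z < b)%R%:R) =
    (b ^+ k.+1 - a ^+ k.+1) / k.+1%:R.
Proof.
move=> a0 ab bt; rewrite mulrBl.
apply: (@avg_annulus t (fun s => s ^+ k.+1 / k.+1%:R) (fun s => s ^+ k)) => //.
- by move=> x /andP[ax _]; rewrite exprn_ge0// (le_trans a0).
- by move=> x _; exact: is_derive_monomial.
- by move=> x _; exact: exprn_continuous.
Qed.

Lemma avg_moment t k : 0 < t ->
  avg t (fun z => nsq z ^+ k) = t ^+ k.+1 / k.+1%:R.
Proof.
move=> t0; have [_] := @avg_annulus_monomial t k 0 t (lexx 0) t0 (lexx t).
rewrite expr0n subr0 => <-; apply: eq_avg => z zt.
by rewrite nsq_ge0 zt mulr1.
Qed.

End modes.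

(** * The obstruction on one disc *)

Section local_bound.
Variable R : realType.
Local Notation t := (4^-1 : R).
Implicit Types (P : {poly R[i]}).

Lemma avg_parseval_wide u (f : R -> R) P n : (size P <= n)%N ->
  tame u (fun z => f (nsq z)) ->
  avg u (fun z => f (nsq z) * nsq P.[z]) =
  \sum_(k < n) nsq P`_k * avg u (fun z => f (nsq z) * nsq z ^+ k).
Proof.
move=> Pn tf; rewrite avg_parseval// (big_ord_widen n (fun k => nsq P`_k *
  avg u (fun z => f (nsq z) * nsq z ^+ k)))// big_mkcond /=.
apply: eq_bigr => k _; case: ifPn => //; rewrite -leqNgt => kP.
by rewrite nth_default// nsq0 mul0r.
Qed.

Lemma tame_poly_nsq u (q : {poly R}) : tame u (fun z => q.[nsq z]).
Proof.
elim/poly_ind: q => [|q c IH].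
  by under eq_fun do rewrite horner0; exact: tame_cst.
under eq_fun do rewrite hornerMXaddC.
by apply: tameD; [apply: tameM => //; exact: tame_nsq|exact: tame_cst].
Qed.

Lemma avg_poly_moment u (q : {poly R}) n k : 0 < u -> (size q <= n)%N ->
  avg u (fun z => q.[nsq z] * nsq z ^+ k) =
  \sum_(j < n) q`_j * (u ^+ (j + k).+1 / (j + k).+1%:R).
Proof.
move=> u0 qn.
rewrite (@eq_avg _ _ _ (fun z => \sum_(j < n) q`_j * nsq z ^+ (j + k))); last first.
  move=> z _; rewrite (horner_coef_wide _ qn) mulr_suml.
  by apply: eq_bigr => j _; rewrite exprD mulrA.
rewrite avg_sum; last first.
  by move=> j; apply: tameM; [exact: tame_cst|apply: tameX; exact: tame_nsq].
apply: eq_bigr => j _; rewrite avgZ ?avg_moment//.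
by apply: tameX; exact: tame_nsq.
Qed.

(** The radial weight [chi], as a polynomial in [s = |z|^2]: with [x = 4 s] it is
    [-18 + 96 x - 89 x^2].  Next to it, [(1 - s)^2 chi] and [chi^2]. *)
Definition chi : {poly R} := Poly [:: -18; 384; -1424].
Definition chi_w : {poly R} := Poly [:: -18; 420; -2210; 3232; -1424].
Definition chi_sq : {poly R} := Poly [:: 18 ^+ 2; - (36 * 384); 384 ^+ 2 + 36 * 1424;
  - (2 * 384 * 1424); 1424 ^+ 2].

Lemma horner_chi s : chi.[s] = -18 + 384 * s - 1424 * s ^+ 2.
Proof. by rewrite horner_Poly /=; ring. Qed.
Lemma horner_chi_w s : chi_w.[s] = (1 - s) ^+ 2 * chi.[s].
Proof. by rewrite horner_chi horner_Poly /=; ring. Qed.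
Lemma horner_chi_sq s : chi_sq.[s] = chi.[s] ^+ 2.
Proof. by rewrite horner_chi horner_Poly /=; ring. Qed.

Lemma size_chi : (size chi <= 3)%N. Proof. exact: size_Poly. Qed.
Lemma size_chi_w : (size chi_w <= 5)%N. Proof. exact: size_Poly. Qed.
Lemma size_chi_sq : (size chi_sq <= 5)%N. Proof. exact: size_Poly. Qed.

(** The sign condition for which the coefficients of [chi] are chosen: only the
    moments of orders one and two may be positive. *)
Lemma chi_w_moment_le0 k : (k == 0%N) || (2 < k)%N ->
  avg t (fun z => chi_w.[nsq z] * nsq z ^+ k) <= 0.
Proof.
move=> kK; rewrite (avg_poly_moment _ _ size_chi_w)//.
rewrite !big_ord_recl big_ord0 /= /bump /= !add1n !add0n !coef_Poly /=.
set y : R := t ^+ k.+1; have y0 : 0 < y by rewrite exprn_gt0.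
have e j : t ^+ (j + k).+1 = t ^+ j * y :> R by rewrite -addnS exprD.
rewrite (e 1%N) (e 2%N) (e 3%N) (e 4%N).
set x : R := k%:R.
have -> : (k.+1%:R : R) = x + 1 by rewrite -natr1.
have -> : ((1 + k).+1%:R : R) = x + 2 by rewrite -natr1 natrD /x; ring.
have -> : ((2 + k).+1%:R : R) = x + 3 by rewrite -natr1 natrD /x; ring.
have -> : ((3 + k).+1%:R : R) = x + 4 by rewrite -natr1 natrD /x; ring.
have -> : ((4 + k).+1%:R : R) = x + 5 by rewrite -natr1 natrD /x; ring.
have x0 : 0 <= x by exact: ler0n.
have -> : -18 * (y / (x + 1)) + (420 * (t ^+ 1 * y / (x + 2)) +
   (-2210 * (t ^+ 2 * y / (x + 3)) + (3232 * (t ^+ 3 * y / (x + 4)) +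
   (-1424 * (t ^+ 4 * y / (x + 5)) + 0)))) =
   y / ((x + 1) * (x + 2) * (x + 3) * (x + 4) * (x + 5)) *
   (- 18 * ((x + 2) * (x + 3) * (x + 4) * (x + 5))
    + 105 * ((x + 1) * (x + 3) * (x + 4) * (x + 5))
    - 1105 / 8 * ((x + 1) * (x + 2) * (x + 4) * (x + 5))
    + 101 / 2 * ((x + 1) * (x + 2) * (x + 3) * (x + 5))
    - 89 / 16 * ((x + 1) * (x + 2) * (x + 3) * (x + 4))).
  by field; rewrite ?pnatr_eq0 //= !gt_eqF ?ltr_wpDl//.
rewrite pmulr_rle0; last first.
  by rewrite divr_gt0// !mulr_gt0// ltr_wpDl.
case/orP: kK => [/eqP k0|k3].
  by rewrite /x k0; lra.
have [z z0 ->] : exists2 z, 0 <= z & x = z + 3.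
  exists (x - 3); last by ring.
  by rewrite subr_ge0 /x ler_nat.
nra.
Qed.

Lemma chi_moment k : avg t (fun z => chi.[nsq z] * nsq z ^+ k) =
  t ^+ k.+1 * (- 18 / k.+1%:R + 96 / k.+2%:R - 89 / k.+3%:R).
Proof.
rewrite (avg_poly_moment _ _ size_chi)//.
rewrite !big_ord_recl big_ord0 /= /bump /= !add1n !add0n !coef_Poly /=.
have e j : t ^+ (j + k).+1 = t ^+ j * t ^+ k.+1 :> R by rewrite -addnS exprD.
rewrite (e 1%N) (e 2%N) -[(1 + k).+1]/(k.+2) -[(2 + k).+1]/(k.+3).
have n0 j : (j.+1%:R : R) != 0 by rewrite pnatr_eq0.
move: (n0 k) (n0 k.+1) (n0 k.+2).
move: (k.+1%:R : R) (k.+2%:R : R) (k.+3%:R : R).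
by move=> x1 x2 x3 h1 h2 h3; field; rewrite h1 h2 h3.
Qed.

Lemma chi_sq_moment k : avg t (fun z => chi_sq.[nsq z] * nsq z ^+ k) =
  t ^+ k.+1 * (324 / k.+1%:R - 3456 / k.+2%:R + 12420 / k.+3%:R
    - 178 * 96 / k.+4%:R + 89 ^+ 2 / k.+4.+1%:R).
Proof.
rewrite (avg_poly_moment _ _ size_chi_sq)//.
rewrite !big_ord_recl big_ord0 /= /bump /= !add1n !add0n !coef_Poly /=.
have e j : t ^+ (j + k).+1 = t ^+ j * t ^+ k.+1 :> R by rewrite -addnS exprD.
rewrite (e 1%N) (e 2%N) (e 3%N) (e 4%N) -[(1 + k).+1]/(k.+2).
rewrite -[(2 + k).+1]/(k.+3) -[(3 + k).+1]/(k.+4) -[(4 + k).+1]/(k.+4.+1).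
have n0 j : (j.+1%:R : R) != 0 by rewrite pnatr_eq0.
move: (n0 k) (n0 k.+1) (n0 k.+2) (n0 k.+3) (n0 k.+4).
move: (k.+1%:R : R) (k.+2%:R : R) (k.+3%:R : R) (k.+4%:R : R) (k.+4.+1%:R : R).
by move=> x1 x2 x3 x4 x5 h1 h2 h3 h4 h5; field; rewrite h1 h2 h3 h4 h5.
Qed.

Lemma tame_chi : tame t (fun z : R[i] => chi.[nsq z]).
Proof. exact: tame_poly_nsq. Qed.

Lemma nsqD_le (x y : R[i]) : nsq (x + y) <= 5 * nsq x + 5 / 4 * nsq y.
Proof.
case: x y => [a b] [c d]; rewrite /nsq /=.
by have := sqr_ge0 (2 * a - c / 2); have := sqr_ge0 (2 * b - d / 2); nra.
Qed.

Lemma nsqD3_le (x y z : R[i]) : nsq (x + y + z) <= 3 * (nsq x + nsq y + nsq z).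
Proof.
case: x y z => [a b] [c d] [e f]; rewrite /nsq /=.
have := sqr_ge0 (a - c); have := sqr_ge0 (c - e); have := sqr_ge0 (a - e).
have := sqr_ge0 (b - d); have := sqr_ge0 (d - f); have := sqr_ge0 (b - f).
nra.
Qed.

(** Some nonzero quadratic polynomial [p] cancels the coefficients of degrees one
    and two in the product [P * p]. *)
Lemma cancel_low_modes P : exists p0 p1 p2 : R[i],
  [/\ 0 < nsq p0 + nsq p1 + nsq p2,
      P`_0 * p1 + P`_1 * p0 = 0 & P`_0 * p2 + P`_1 * p1 + P`_2 * p0 = 0].
Proof.
have [P0|P0] := eqVneq P`_0 0.
  exists 0, 0, 1; rewrite P0 nsq0 nsq1; split; [by rewrite !add0r|by ring|by ring].
exists 1, (- P`_1 / P`_0), ((P`_1 ^+ 2 / P`_0 - P`_2) / P`_0); split.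
- by rewrite nsq1 -addrA ltr_pwDl// addr_ge0// nsq_ge0.
- by field.
- by field.
Qed.

(** The zero-packing obstruction on a disc of pseudohyperbolic radius [1/2].  With
    [psi = chi |p|^2] and [u] as above, the integral of [u^2 psi] is nonpositive,
    that of [psi] is positive, and [psi] is bounded below and square-integrable; so
    the mean square of [u - 1] cannot be small. *)
Lemma avg_discrepancy_ge P :
  10 ^- 4 <= avg t (fun z => ((1 - nsq z) * cmod P.[z] - 1) ^+ 2).
Proof.
have t0 : 0 < t by rewrite invr_gt0.
set E := avg t _; rewrite leNgt; apply/negP => Elt.
have [p0 [p1 [p2 [ppos c1 c2]]]] := cancel_low_modes P.
pose p : {poly R[i]} := Poly [:: p0; p1; p2].
pose p' : {poly R[i]} := Poly [:: p0 ^+ 2; 2 * p0 * p1; p1 ^+ 2 + 2 * p0 * p2;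
                                2 * p1 * p2; p2 ^+ 2].
have p'E z : p'.[z] = p.[z] ^+ 2 by rewrite !horner_Poly /=; ring.
have ps : (size p <= 3)%N by exact: size_Poly.
have p's : (size p' <= 5)%N by exact: size_Poly.
have p_0 : p`_0 = p0 by rewrite coef_Poly.
have p_1 : p`_1 = p1 by rewrite coef_Poly.
have p_2 : p`_2 = p2 by rewrite coef_Poly.
have p'_0 : p'`_0 = p0 ^+ 2 by rewrite coef_Poly.
have p'_1 : p'`_1 = 2 * p0 * p1 by rewrite coef_Poly.
have p'_2 : p'`_2 = p1 ^+ 2 + 2 * p0 * p2 by rewrite coef_Poly.
have p'_3 : p'`_3 = 2 * p1 * p2 by rewrite coef_Poly.
have p'_4 : p'`_4 = p2 ^+ 2 by rewrite coef_Poly.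
pose a := nsq p0; pose b := nsq p1 / 4; pose c := nsq p2 / 16.
have a0 : 0 <= a by exact: nsq_ge0.
have b0 : 0 <= b by rewrite divr_ge0// nsq_ge0.
have c0 : 0 <= c by rewrite divr_ge0// nsq_ge0.
have abc : 0 < a + b + c by rewrite /a /b /c; move: ppos (nsq_ge0 p0) (nsq_ge0 p1); lra.
have tp : tame t (fun z => nsq p.[z]) by exact: tame_nsq_horner.
have tu : tame t (fun z => (1 - nsq z) * cmod P.[z] - 1).
  apply: tameB; last exact: tame_cst.
  apply: tameM; last exact: tame_cmod_horner.
  by apply: tameB; [exact: tame_cst|exact: tame_nsq].
have tE : tame t (fun z => ((1 - nsq z) * cmod P.[z] - 1) ^+ 2) by exact: tameX.
have tPsi : tame t (fun z => chi.[nsq z] * nsq p.[z]) by apply: tameM; [exact: tame_chi|].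
have tPsi2 : tame t (fun z => (chi.[nsq z] * nsq p.[z]) ^+ 2) by exact: tameX.
(* The product [P p] has no modes of orders one and two; all others contribute a
   nonpositive term. *)
have neg : avg t (fun z => ((1 - nsq z) * cmod P.[z]) ^+ 2 *
                           (chi.[nsq z] * nsq p.[z])) <= 0.
  rewrite (@eq_avg _ _ _ (fun z => chi_w.[nsq z] * nsq (P * p).[z])); last first.
    move=> z _; rewrite horner_chi_w hornerM nsqM exprMn cmod_sqr; ring.
  rewrite avg_parseval; last exact: tame_poly_nsq.
  apply: sumr_le0 => k _.
  have [k1|k1] := eqVneq (k : nat) 1%N.
    rewrite k1 coefM !big_ord_recl big_ord0 /= !coef_Poly /= /bump /=.
    by rewrite addr0 c1 nsq0 mul0r.
  have [k2|k2] := eqVneq (k : nat) 2%N.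
    rewrite k2 coefM !big_ord_recl big_ord0 /= !coef_Poly /= /bump /=.
    by rewrite addr0 addrA c2 nsq0 mul0r.
  apply: mulr_ge0_le0; first exact: nsq_ge0.
  apply: chi_w_moment_le0; move: k1 k2; case: (k : nat) => [|[|[|]]]//.
have psiE : avg t (fun z => chi.[nsq z] * nsq p.[z]) = (a / 3 + 3 * b / 4 + c / 5) / 4.
  rewrite (avg_parseval_wide ps); last exact: tame_chi.
  rewrite !big_ord_recl big_ord0 /= /bump /= !chi_moment /= p_0 p_1 p_2 /a /b /c.
  by field.
pose B := 7 / 2 * a + 4 * b + 11 / 5 * c.
have B0 : 0 < B by rewrite /B; lra.
have psi2 : avg t (fun z => (chi.[nsq z] * nsq p.[z]) ^+ 2) <= B ^+ 2.
  rewrite (@eq_avg _ _ _ (fun z => chi_sq.[nsq z] * nsq p'.[z])); last first.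
    by move=> z _; rewrite horner_chi_sq p'E nsqX exprMn.
  rewrite (avg_parseval_wide p's); last exact: tame_poly_nsq.
  rewrite !big_ord_recl big_ord0 /= /bump /= !add1n !chi_sq_moment.
  rewrite p'_0 p'_1 p'_2 p'_3 p'_4.
  have n2 : nsq (2 : R[i]) = 4 by rewrite /nsq /=; ring.
  rewrite !nsqM n2.
  have q2 := nsqD_le (p1 ^+ 2) (2 * p0 * p2).
  rewrite !nsqM n2 in q2.
  have -> : nsq p0 = a by [].
  have ep1 : nsq p1 = 4 * b by rewrite /b; field.
  have ep2 : nsq p2 = 16 * c by rewrite /c; field.
  rewrite ep1 ep2 in q2 *; rewrite /B.
  have [ab bc ca] : [/\ 0 <= a * b, 0 <= b * c & 0 <= a * c].
    by split; exact: mulr_ge0.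
  set N := nsq (_ + _) in q2 *.
  have := sqr_ge0 a; have := sqr_ge0 b; have := sqr_ge0 c.
  rewrite -/a in q2; by move: q2 ab bc ca; clear; lra.
(* In [2 (u - 1) psi >= - T (u - 1)^2 - psi^2 / T], the value of [T] makes the last term
   a small fraction of the integral of [psi]; [- M] is a lower bound of [psi]. *)
pose T := 100 * B; have T0 : 0 < T by rewrite mulr_gt0.
pose M := 54 * (a + b + c).
have Ege0 : 0 <= E by apply: avg_ge0 => z _; exact: sqr_ge0.
have main : avg t (fun z => chi.[nsq z] * nsq p.[z]) <=
    (T + M) * E + T^-1 * avg t (fun z => (chi.[nsq z] * nsq p.[z]) ^+ 2).
  pose F z := ((1 - nsq z) * cmod P.[z]) ^+ 2 * (chi.[nsq z] * nsq p.[z]).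
  have tF : tame t F.
    apply: tameM => //; apply: tameX; apply: tameM; last exact: tame_cmod_horner.
    by apply: tameB; [exact: tame_cst|exact: tame_nsq].
  have tEE : tame t (fun z => (T + M) * ((1 - nsq z) * cmod P.[z] - 1) ^+ 2).
    by apply: tameM => //; exact: tame_cst.
  have tPP : tame t (fun z => T^-1 * (chi.[nsq z] * nsq p.[z]) ^+ 2).
    by apply: tameM => //; exact: tame_cst.
  apply: (@le_trans _ _ (avg t (fun z => F z +
    ((T + M) * ((1 - nsq z) * cmod P.[z] - 1) ^+ 2 +
     T^-1 * (chi.[nsq z] * nsq p.[z]) ^+ 2)))); last first.
    rewrite avgD//; last exact: tameD.
    by rewrite avgD// !avgZ// gerDr.
  apply: le_avg => //; first by apply: tameD => //; exact: tameD.
  move=> z zt; rewrite /F; set v := (1 - nsq z) * cmod P.[z]; set psi := _ * nsq p.[z].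
  have psiM : 0 <= psi + M.
    have s0 := nsq_ge0 z; rewrite /psi horner_chi /M.
    have p3 := nsqD3_le p0 (p1 * z) (p2 * z ^+ 2).
    have -> : p.[z] = p0 + p1 * z + p2 * z ^+ 2 by rewrite horner_Poly /=; ring.
    rewrite !nsqM in p3.
    have pab : nsq (p0 + p1 * z + p2 * z ^+ 2) <= 3 * (a + b + c).
      apply: (le_trans p3); rewrite ler_pM2l// lerD//; first rewrite lerD//.
        by rewrite /b ler_wpM2l ?nsq_ge0// ltW.
      rewrite /c ler_wpM2l ?nsq_ge0//.
      have -> : 16^-1 = t * t by field.
      by apply: ler_pM => //; rewrite ltW.
    set X := nsq (_ + _ + _) in pab *.
    have X0 : 0 <= X by exact: nsq_ge0.
    have chi18 : -18 <= -18 + 384 * nsq z - 1424 * nsq z ^+ 2 by nra.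
    have : -18 * X <= (-18 + 384 * nsq z - 1424 * nsq z ^+ 2) * X by rewrite ler_wpM2r.
    by lra.
  have -> : v = (v - 1) + 1 by ring.
  set w := v - 1; rewrite addrK.
  have e : (w + 1) ^+ 2 * psi + ((T + M) * w ^+ 2 + T^-1 * psi ^+ 2) - psi =
      w ^+ 2 * (psi + M) + T * (w + psi / T) ^+ 2 by field; rewrite gt_eqF.
  rewrite -subr_ge0 e addr_ge0// mulr_ge0// ?sqr_ge0// ltW//.
rewrite psiE in main.
have h1 : (T + M) * E <= (T + M) * 10 ^- 4.
  by rewrite ler_pM2l ?ltW// addr_gt0// /M mulr_gt0.
have h2 : T^-1 * avg t (fun z => (chi.[nsq z] * nsq p.[z]) ^+ 2) <= B / 100.
  rewrite ler_pdivrMl// (le_trans psi2)// /T expr2; lra.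
rewrite /T /M /B in main h1 h2; lra.
Qed.

End local_bound.

(** * Uniform limits of polynomials *)

Section transfer.
Variable R : realType.
Local Notation mR := (measurableTypeR R).
Local Notation t := (4^-1 : R).
Implicit Types (F G : R[i] -> R[i]).

(** Uniform limits of polynomials on the disc [|w| < 1/2]. *)
Definition approximable F := forall e : R, 0 < e ->
  exists P : {poly R[i]}, forall w, nsq w < t -> cmod (F w - P.[w]) <= e.

Lemma approximable_bounded F : approximable F ->
  exists2 M, 0 < M & forall w, nsq w < t -> cmod (F w) <= M.
Proof.
move=> /(_ 1 ltr01)[P FP]; have [_ [M PM]] := tame_cmod_horner t P.
exists (1 + Num.max M 0); first by rewrite ltr_pwDl// le_max lexx orbT.
move=> w wt; rewrite -[F w](subrK P.[w]) (le_trans (cmodD _ _))// lerD ?FP//.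
by rewrite le_max (le_trans (ler_norm _) (PM _ wt)).
Qed.

Lemma approximableD F G : approximable F -> approximable G ->
  approximable (fun w => F w + G w).
Proof.
move=> aF aG e e0; have e2 : 0 < e / 2 by rewrite divr_gt0.
have [P FP] := aF _ e2; have [Q GQ] := aG _ e2; exists (P + Q) => w wt.
rewrite hornerD [e]splitr opprD addrACA (le_trans (cmodD _ _))// lerD ?FP ?GQ//.
Qed.

Lemma approximableM F G : approximable F -> approximable G ->
  approximable (fun w => F w * G w).
Proof.
move=> aF aG e e0.
have [M M0 FM] := approximable_bounded aF.
have [Q GQ] := aG (e / (2 * M)) ltac:(by rewrite divr_gt0// mulr_gt0).
have [_ [N' QN']] := tame_cmod_horner t Q.
pose N := 1 + Num.max N' 0.
have N0 : 0 < N by rewrite ltr_pwDl// le_max lexx orbT.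
have QN w : nsq w < t -> cmod Q.[w] <= N.
  move=> wt; apply: (@le_trans _ _ (Num.max N' 0)); last by rewrite lerDr.
  by rewrite le_max (le_trans (ler_norm _) (QN' _ wt)).
have [P FP] := aF (e / (2 * N)) ltac:(by rewrite divr_gt0// mulr_gt0).
exists (P * Q) => w wt; rewrite hornerM.
have -> : F w * G w - P.[w] * Q.[w] = F w * (G w - Q.[w]) + (F w - P.[w]) * Q.[w].
  by ring.
rewrite (le_trans (cmodD _ _))// !cmodM [leRHS]splitr lerD//.
- have -> : e / 2 = M * (e / (2 * M)) by field; rewrite gt_eqF.
  by rewrite ler_pM ?cmod_ge0// ?FM ?GQ.
- have -> : e / 2 = (e / (2 * N)) * N by field; rewrite gt_eqF.
  by rewrite ler_pM ?cmod_ge0// ?QN ?FP.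
Qed.

Lemma approximable_horner (f : {poly R[i]}) F : approximable F ->
  approximable (fun w => f.[F w]).
Proof.
move=> aF; elim/poly_ind: f => [|f c IH].
  by move=> e e0; exists 0 => w _; rewrite !horner0 subrr cmod0 ltW.
under eq_fun do rewrite hornerMXaddC.
apply: approximableD; first exact: approximableM.
by move=> e e0; exists c%:P => w _; rewrite hornerC subrr cmod0 ltW.
Qed.

Lemma cmod_half (w : R[i]) : nsq w < t -> cmod w <= 2^-1.
Proof.
move=> wt; rewrite ltW// cmod_lt ?invr_ge0//.
by rewrite (lt_le_trans wt)// expr2; lra.
Qed.

Lemma approximable_mobius_pole (a : R) : 0 < a < 1 ->
  approximable (fun w => (1 + a%:C%C * w)^-1).
Proof.
move=> /andP[a0 a1] e e0; set ac := a%:C%C.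
have [n ne] : exists n, 2 * (2^-1) ^+ n <= e.
  exists (Num.bound (2 / e)).
  have := upper_nthrootP (leqnn (Num.bound (2 / e))).
  rewrite ltr_pdivrMr// => /ltW h.
  by rewrite exprVn ler_pdivrMr ?exprn_gt0// mulrC.
pose P : {poly R[i]} := \poly_(k < n) (- ac) ^+ k.
exists P => w wt.
have wh := cmod_half wt.
have cac : cmod ac = a by rewrite cmodE nsq_real sqrtr_sqr gtr0_norm.
have q2 : cmod (- (ac * w)) <= 2^-1.
  by rewrite cmodN cmodM cac -[leRHS]mul1r ler_pM ?cmod_ge0// ltW.
have D2 : 2^-1 <= cmod (1 + ac * w).
  have : 1 <= cmod (1 + ac * w) + cmod (- (ac * w)).
    by rewrite -{1}cmod1 -{1}(addrK (ac * w) 1) cmodD.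
  by lra.
have D0 : 1 + ac * w != 0.
  by apply: contraTneq D2 => ->; rewrite cmod0 -ltNge invr_gt0.
have -> : P.[w] = (1 - (- (ac * w)) ^+ n) / (1 + ac * w).
  rewrite horner_poly; apply: (mulIf D0); rewrite mulfVK//.
  have -> : 1 + ac * w = 1 - (- (ac * w)) by rewrite opprK.
  rewrite -[X in X - _ ^+ n](expr1n _ n) subrXX mulrC; congr (_ * _).
  by apply: eq_bigr => k _; rewrite expr1n mul1r -mulNr exprMn.
have -> : (1 + ac * w)^-1 - (1 - (- (ac * w)) ^+ n) / (1 + ac * w) =
    (- (ac * w)) ^+ n / (1 + ac * w) by field.
apply: le_trans ne; rewrite cmodM cmodV cmodX mulrC ler_pM ?invr_ge0 ?cmod_ge0//.
- by rewrite exprn_ge0// cmod_ge0.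
- by rewrite -[leRHS]invrK lef_pV2 ?posrE ?invr_gt0// (lt_le_trans _ D2)// invr_gt0.
- by rewrite lerXn2r ?nnegrE ?cmod_ge0 ?invr_ge0.
Qed.

(** The obstruction persists for uniform limits of polynomials. *)
Lemma avg_discrepancy_approximable_ge F : approximable F ->
  measC (fun p : mR * mR => F (toC p)) ->
  tame t (fun w => (1 - nsq w) * cmod (F w) - 1) /\
  10 ^- 4 <= avg t (fun w => ((1 - nsq w) * cmod (F w) - 1) ^+ 2).
Proof.
move=> aF mF.
have t0 : 0 < t by rewrite invr_gt0.
have tame_u (g : R[i] -> R) : tame t g -> tame t (fun w => (1 - nsq w) * g w - 1).
  move=> tg; apply: tameB; last exact: tame_cst.
  by apply: tameM => //; apply: tameB; [exact: tame_cst|exact: tame_nsq].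
have tF : tame t (fun w => cmod (F w)).
  split; first exact: measurable_cmod.
  have [M _ FM] := approximable_bounded aF.
  by exists M => w wt; rewrite ger0_norm ?cmod_ge0// FM.
split; first exact: tame_u.
set E := avg t _; rewrite leNgt; apply/negP => Elt.
have E0 : 0 <= E by apply: avg_ge0 => w _; exact: sqr_ge0.
pose e : R := (10 ^- 4 - E) / 4.
have e0 : 0 < e by rewrite divr_gt0// subr_gt0.
have e1 : e <= 1 by rewrite /e; move: E0; lra.
have [P FP] := aF _ e0.
have /le_lt_trans := avg_discrepancy_ge P.
suff /[swap]/[apply] : avg t (fun w => ((1 - nsq w) * cmod P.[w] - 1) ^+ 2) < 10 ^- 4.
  by rewrite ltxx.
have tuF := tame_u _ tF; have tuP := tame_u _ (tame_cmod_horner t P).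
apply: (@le_lt_trans _ _ (avg t (fun w =>
    (1 + e) * ((1 - nsq w) * cmod (F w) - 1) ^+ 2 + (e + e ^+ 2)))).
  apply: le_avg.
  - exact: tameX.
  - apply: tameD; last exact: tame_cst.
    by apply: tameM; [exact: tame_cst|exact: tameX].
  move=> w wt; set x := _ * cmod (F w) - 1; set y := _ * cmod P.[w] - 1.
  have xy : `|y - x| <= e.
    have -> : y - x = (1 - nsq w) * (cmod P.[w] - cmod (F w)) by rewrite /x /y; ring.
    have n0 := nsq_ge0 w; have n1 : nsq w < 1 by rewrite (lt_trans wt)// invf_lt1// ltr1n.
    have nn : `|1 - nsq w| <= 1.
      by rewrite ger0_norm ?subr_ge0 ?(ltW n1)// gerBl.
    rewrite normrM -[leRHS]mul1r; apply: ler_pM => //.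
    have h1 := cmodD (F w) (P.[w] - F w); have h2 := cmodD P.[w] (F w - P.[w]).
    rewrite !subrKC in h1 h2; have h3 := FP _ wt; have h4 := h3.
    rewrite -cmodN opprB in h4; rewrite ler_norml; apply/andP; split; lra.
  move: xy; rewrite ler_norml => /andP[xy1 xy2].
  have d1 : 0 <= e - (y - x) by lra.
  have d2 : 0 <= e + (y - x) by lra.
  have := mulr_ge0 d1 d2; have := mulr_ge0 d1 (sqr_ge0 (x + 1)).
  have := mulr_ge0 d2 (sqr_ge0 (x - 1)).
  by clear; lra.
rewrite avgD; last 2 first.
- by apply: tameM; [exact: tame_cst|exact: tameX].
- exact: tame_cst.
rewrite avgZ ?avg_cst ?ltW//; last exact: tameX.
rewrite -/E; move: E0 Elt e0 e1; rewrite /e; nra.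
Qed.

End transfer.

(** * The obstruction on hyperbolic discs *)

Section mobius_discs.
Variable R : realType.
Local Notation mR := (measurableTypeR R).
Implicit Types (f : {poly R[i]}) (z w om : R[i]).

(** Density of the discrepancy of [f]; the absolute value of [1 - |z|^2] makes it
    nonnegative on the whole plane, and changes nothing inside the unit disc. *)
Definition hdens f z : R := ((1 - nsq z) * cmod f.[z] - 1) ^+ 2 * `|1 - nsq z|^-1.

Lemma hdens_ge0 f z : 0 <= hdens f z.
Proof. by rewrite mulr_ge0 ?sqr_ge0// invr_ge0. Qed.

Lemma measurable_hdens f :
  measurable_fun setT (fun p : mR * mR => hdens f (toC p)).
Proof.
have mn : measurable_fun setT (fun p : mR * mR => 1 - nsq (toC p)).
  by apply: measurable_funB => //; apply: measurable_nsq; exact: measC_toC.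
apply: measurable_funM.
  apply: measurable_funX; apply: measurable_funB => //; apply: measurable_funM => //.
  by apply: measurable_cmod; apply: measC_horner; exact: measC_toC.
by apply: measurable_fun_inv => //; exact: (measurableT_comp (@normr_measurable _ _)).
Qed.

(** Indicator of the image of [|w|^2 < 1/4] under [w |-> om (w + a) / (1 + a w)]. *)
Definition in_mobius_disc (a : R) om z : bool :=
  nsq (conjc om * z - a%:C%C) < 4^-1 * nsq (1 - a%:C%C * (conjc om * z)).

Lemma measurable_in_mobius_disc a (om : R[i]) :
  measurable_fun setT (fun p : mR * mR => in_mobius_disc a om (toC p)).
Proof.
have mz : measC (fun p : mR * mR => conjc om * toC p).
  by apply: measCM; [exact: measC_cst|exact: measC_toC].
apply: measurable_fun_ltr.
  by apply: measurable_nsq; apply: measCD => //; exact: measC_cst.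
apply: measurable_funM => //; apply: measurable_nsq; apply: measCD; first exact: measC_cst.
by apply: measCN; apply: measCM => //; exact: measC_cst.
Qed.

(** With [z] the image of [w], the function [F (w) = (1 - a^2) f (z) / (1 + a w)^2]
    satisfies [(1 - |w|^2) |F (w)| = (1 - |z|^2) |f (z)|], so the obstruction applies
    to [F].  The factor [4 / 9] bounds [1 / |1 + a w|^2] from below. *)
Lemma mobius_disc_discrepancy (a : R) om f : 0 < a < 1 -> nsq om = 1 ->
  ((4 / 9 * (1 - a ^+ 2) * 10 ^- 4)%:E <=
   \int[dA R]_p (hdens f (toC p) * (in_mobius_disc a om (toC p))%:R)%:E)%E.
Proof.
move=> a01 om1; have /andP[a0 a1] := a01.
set h := 1 - a ^+ 2; have h0 : 0 < h by rewrite subr_gt0 expr_lt1// ltW.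
set ac := a%:C%C.
pose D w := 1 + ac * w.
pose mob w := om * ((w + ac) / D w).
pose F w := h%:C%C * f.[mob w] * ((D w)^-1 * (D w)^-1).
have acst c : approximable (fun=> c : R[i]).
  by move=> e e0; exists c%:P => w _; rewrite hornerC subrr cmod0 ltW.
have aid : approximable (fun w : R[i] => w).
  by move=> e e0; exists 'X => w _; rewrite hornerX subrr cmod0 ltW.
have aD : approximable (fun w => (D w)^-1) by exact: approximable_mobius_pole.
have amob : approximable mob.
  by apply: approximableM => //; apply: approximableM => //; exact: approximableD.
have aF : approximable F.
  apply: approximableM; last exact: approximableM.
  by apply: approximableM => //; exact: approximable_horner.
have mD : measC (fun p : mR * mR => D (toC p)) by exact: measC_affine.
have mmob : measC (fun p : mR * mR => mob (toC p)).
  apply: measCM; first exact: measC_cst.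
  apply: measCM; last exact: measCV.
  by apply: measCD; [exact: measC_toC|exact: measC_cst].
have mF : measC (fun p : mR * mR => F (toC p)).
  apply: measCM; last by apply: measCM; exact: measCV.
  by apply: measCM; [exact: measC_cst|exact: measC_horner].
have [tu] := avg_discrepancy_approximable_ge aF mF.
set u := fun w => _ in tu; move=> uge.
have mhd : measP (fun z => (hdens f z)%:E) by apply/measurable_EFinP; exact: measurable_hdens.
have mind : measurable_fun setT (fun p : mR * mR => (in_mobius_disc a om (toC p))%:R : R).
  by apply: measurable_bool_indicator; exact: measurable_in_mobius_disc.
under eq_integral do rewrite EFinM.
rewrite (dA_planar (F := fun z => (hdens f z)%:E * (in_mobius_disc a om z)%:R%:E)%E); last 2 first.
- by apply: emeasurable_funM => //; exact/measurable_EFinP.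
- by move=> z; rewrite mule_ge0// lee_fin ?hdens_ge0.
rewrite /in_mobius_disc planar_mobius//; last by move=> z; rewrite lee_fin hdens_ge0.
rewrite -dA_planar; last 2 first.
- apply: emeasurable_funM; first exact: (measurable_compC mhd).
  apply: emeasurable_funM; apply/measurable_EFinP.
    apply: measurable_funM => //; apply: measurable_funX; apply: measurable_fun_inv.
      by move=> p; exact: nsq_ge0.
    exact: measurable_nsq.
  apply: measurable_bool_indicator; apply: measurable_fun_ltr => //.
  by apply: measurable_nsq; exact: measC_toC.
- move=> w; rewrite !mule_ge0 ?lee_fin ?hdens_ge0//.
  by rewrite mulr_ge0// ?invr_ge0 sqr_ge0.
have tv : tame 4^-1 (fun w => 4 / 9 * h * u w ^+ 2).
  by apply: tameM; [exact: tame_cst|exact: tameX].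
apply: (@le_trans _ _ (avg 4^-1 (fun w => 4 / 9 * h * u w ^+ 2))%:E).
  rewrite lee_fin avgZ; last exact: tameX.
  by apply: ler_wpM2l => //; rewrite mulr_ge0 ?ltW.
rewrite avgE//.
rewrite integral_mkcond.
have mw := measurable_nsq (@measC_toC R).
apply: ge0_le_integral => //.
- move=> p _; rewrite patchE; case: ifP => // _.
  by rewrite lee_fin mulr_ge0 ?sqr_ge0// mulr_ge0 ?ltW.
- apply/(measurable_restrictT _ (measurable_sdisc _)).
  apply: measurable_funTS; apply/measurable_EFinP; exact: tv.1.
- apply: emeasurable_funM; first exact: (measurable_compC mhd).
  apply: emeasurable_funM; apply/measurable_EFinP.
    apply: measurable_funM => //; apply: measurable_funX; apply: measurable_fun_inv.
      by move=> p; exact: nsq_ge0.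
    exact: measurable_nsq.
  exact/measurable_bool_indicator/measurable_fun_ltr.
move=> p _; rewrite patchE; set w := toC p.
rewrite -!EFinM.
case: ifPn => [|_]; last first.
  rewrite lee_fin mulr_ge0 ?hdens_ge0// mulr_ge0 ?ler0n//.
  by apply: mulr_ge0; exact: sqr_ge0.
rewrite inE /sdisc /= => wt; rewrite -/w in wt *; rewrite wt mulr1 lee_fin.
have n0 := nsq_ge0 w.
have Dw : cmod (D w) <= 3 / 2.
  apply: (le_trans (cmodD _ _)); rewrite cmod1 cmodM.
  have -> : cmod ac = a by rewrite cmodE nsq_real sqrtr_sqr gtr0_norm.
  by have := cmod_half wt; have := cmod_ge0 w; nra.
have D94 : nsq (D w) <= 9 / 4 by rewrite -cmod_sqr; have := cmod_ge0 (D w); nra.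
have D0 : 0 < nsq (D w).
  have : 1 <= cmod (D w) + cmod (- (ac * w)).
    by rewrite -{1}cmod1 -{1}(addrK (ac * w) 1) cmodD.
  rewrite cmodN cmodM.
  have -> : cmod ac = a by rewrite cmodE nsq_real sqrtr_sqr gtr0_norm.
  move=> h1; rewrite -cmod_sqr exprn_gt0//.
  by have := cmod_half wt; have := cmod_ge0 w; nra.
have ez : 1 - nsq (mob w) = (1 - nsq w) * h / nsq (D w).
  rewrite /mob !nsqM om1 mul1r nsqV.
  apply: (mulIf (x := nsq (D w))); first by rewrite gt_eqF.
  rewrite mulrBl !mulfVK ?gt_eqF// mul1r /D /h /ac.
  by case: (w) => x y; rewrite /nsq /=; ring.
rewrite -/(D w) -/(mob w).
have eu : (1 - nsq (mob w)) * cmod f.[mob w] - 1 = u w.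
  rewrite ez /u /F !cmodM cmodV.
  have -> : cmod h%:C%C = h by rewrite cmodE nsq_real sqrtr_sqr gtr0_norm.
  by rewrite -[nsq (D w)]cmod_sqr expr2 invfM; ring.
rewrite /hdens eu ez ger0_norm; last first.
  by rewrite divr_ge0 ?mulr_ge0 ?ltW//; lra.
have nw : 0 < 1 - nsq w by lra.
have -> : u w ^+ 2 * ((1 - nsq w) * h / nsq (D w))^-1 * (h ^+ 2 * (nsq (D w))^-1 ^+ 2) =
   ((1 - nsq w) * nsq (D w))^-1 * (h * u w ^+ 2).
  by field; rewrite !gt_eqF.
rewrite -mulrA; apply: ler_wpM2r; first by rewrite mulr_ge0 ?sqr_ge0// ltW.
rewrite -[leLHS]invrK lef_pV2 ?posrE ?mulr_gt0 ?invr_gt0//.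
have -> : (4 / 9 : R)^-1 = 9 / 4 by rewrite invf_div.
by nra.
Qed.

End mobius_discs.

(** * Packing hyperbolic discs in rows *)

Section packing.
Variable R : realType.
Implicit Types (z om : R[i]) (A : R).

Lemma sum_disjoint_indicators (I : finType) (b : I -> bool) (c : bool) :
  (forall i j, b i -> b j -> i = j) -> (forall i, b i -> c) ->
  \sum_i (b i)%:R <= c%:R :> R.
Proof.
move=> bij bc; case: (pickP b) => [i bi|b0]; last first.
  by rewrite big1 ?ler0n// => i _; rewrite b0.
rewrite (bc _ bi) (bigD1 i)//= bi big1 ?addr0// => j ji.
by case bj : (b j) => //; move: ji; rewrite (bij _ _ bj bi) eqxx.
Qed.

(** In the row of parameter [A] the origin is sent to distance [hcenter A] from the
    centre of the unit disc, that is, [(1 + hcenter A) / (1 - hcenter A) = A].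
    [ecenter A] and [eradius A] are the distance from the origin of the Euclidean
    centre of the discs, and their Euclidean radius. *)
Definition hcenter A := (A - 1) / (A + 1).
Definition ecenter A := 3 * (A ^+ 2 - 1) / ((3 * A + 1) * (A + 3)).
Definition eradius A := 8 * A / ((3 * A + 1) * (A + 3)).

Lemma in_mobius_disc_euclid A om z : 81 <= A -> nsq om = 1 ->
  in_mobius_disc (hcenter A) om z ->
  nsq (z - (ecenter A)%:C%C * om) < eradius A ^+ 2.
Proof.
move=> A81 om1; rewrite /in_mobius_disc.
set w := conjc om * z => h.
have -> : z - (ecenter A)%:C%C * om = om * (w - (ecenter A)%:C%C).
  by rewrite /w mulrBr mulrA [om * conjc om]mulrC conjcM_nsq om1 mul1r [om * _]mulrC.
rewrite nsqM om1 mul1r; move: h; case: w => x y.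
have A1 : A + 1 != 0 by apply/eqP; lra.
have A3 : A + 3 != 0 by apply/eqP; lra.
have A4 : 3 * A + 1 != 0 by apply/eqP; lra.
have k0 : 0 < 4^-1 * (3 * A + 1) * (A + 3) / (A + 1) ^+ 2.
  by rewrite divr_gt0 ?exprn_gt0 ?mulr_gt0//; lra.
move=> h; rewrite -subr_gt0 -(pmulr_rgt0 _ k0).
rewrite -subr_gt0 in h; move: h; congr (is_true (0 < _)); rewrite /nsq /hcenter /ecenter /eradius /=.
by field; rewrite A1 A3 A4.
Qed.

Lemma in_mobius_disc_annulus A om z : 81 <= A -> nsq om = 1 ->
  in_mobius_disc (hcenter A) om z ->
  (A - 3) / (A + 3) < cmod z < (3 * A - 1) / (3 * A + 1).
Proof.
move=> A81 om1 /(in_mobius_disc_euclid A81 om1).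
have d0 : 0 < (3 * A + 1) * (A + 3) by rewrite mulr_gt0//; lra.
have r0 : 0 < eradius A by rewrite divr_gt0//; lra.
have c0 : 0 < ecenter A by rewrite divr_gt0//; nra.
rewrite -cmod_lt ?ltW// => h.
have e1 : (A - 3) / (A + 3) = ecenter A - eradius A.
  by rewrite /ecenter /eradius; field; apply/andP; split; apply/eqP; lra.
have e2 : (3 * A - 1) / (3 * A + 1) = ecenter A + eradius A.
  by rewrite /ecenter /eradius; field; apply/andP; split; apply/eqP; lra.
have cc : cmod ((ecenter A)%:C%C * om) = ecenter A.
  by rewrite cmodE nsqM om1 mulr1 nsq_real sqrtr_sqr gtr0_norm.
have h1 := cmodD z (- (z - (ecenter A)%:C%C * om)).
have h2 := cmodD (z - (ecenter A)%:C%C * om) ((ecenter A)%:C%C * om).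
rewrite subKr cc cmodN in h1; rewrite subrK cc in h2.
by rewrite e1 e2; apply/andP; split; lra.
Qed.

(** The annuli of rows whose parameters have ratio at least [9] are disjoint. *)
Lemma row_annuli_disjoint A B (x : R) : 81 <= A -> 9 * A <= B ->
  x < (3 * A - 1) / (3 * A + 1) -> (B - 3) / (B + 3) < x -> False.
Proof.
move=> A81 AB; rewrite ltr_pdivlMr ?ltr_pdivrMr; try lra.
by nra.
Qed.

Lemma in_mobius_disc_close A om om' z : 81 <= A -> nsq om = 1 -> nsq om' = 1 ->
  in_mobius_disc (hcenter A) om z -> in_mobius_disc (hcenter A) om' z ->
  cmod (om - om') < 2 * (eradius A / ecenter A).
Proof.
move=> A81 o1 o2 /(in_mobius_disc_euclid A81 o1) h1 /(in_mobius_disc_euclid A81 o2) h2.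
have d0 : 0 < (3 * A + 1) * (A + 3) by rewrite mulr_gt0//; lra.
have r0 : 0 < eradius A by rewrite divr_gt0//; lra.
have c0 : 0 < ecenter A by rewrite divr_gt0//; nra.
rewrite -cmod_lt ?ltW// in h1; rewrite -cmod_lt ?ltW// in h2.
set c := ecenter A in c0 h1 h2 *.
have h3 := cmodD (z - c%:C%C * om') (- (z - c%:C%C * om)).
have e3 : z - c%:C%C * om' - (z - c%:C%C * om) = c%:C%C * (om - om') by ring.
rewrite e3 cmodN cmodM in h3.
have cc : cmod c%:C%C = c by rewrite cmodE nsq_real sqrtr_sqr gtr0_norm.
rewrite cc in h3.
by rewrite mulrA ltr_pdivlMr// mulrC; lra.
Qed.

(** A row: at least [9 / (8 h)] pairs of disjoint discs, [h = 1 - hcenter A ^ 2],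
    centred symmetrically about the real axis. *)
Lemma mobius_disc_row A : 81 <= A ->
  exists M (om : 'I_M * bool -> R[i]),
    [/\ forall i, nsq (om i) = 1,
        forall z i j, in_mobius_disc (hcenter A) (om i) z ->
          in_mobius_disc (hcenter A) (om j) z -> i = j
      & 9 / 4 <= M%:R * 2 * (1 - hcenter A ^+ 2)].
Proof.
move=> A81.
(* Centres whose directions are at distance at least [2 eta] give disjoint discs; the
   abscissae of the directions are spaced by [2 eta] and stay within [1 - eta], which
   keeps the two points of each abscissa far enough apart. *)
pose eta := eradius A / ecenter A.
have etaE : eta = 8 * A / (3 * (A ^+ 2 - 1)).
  by rewrite /eta /eradius /ecenter; field; rewrite !lt0r_neq0//; try lra; nra.
have A0 : 0 < A ^+ 2 - 1 by nra.
have e0 : 0 < eta by rewrite etaE divr_gt0//; lra.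
have e1 : eta <= 1 by rewrite etaE ler_pdivrMr; nra.
pose M := Num.truncn eta^-1.
have ie0 : 0 <= eta^-1 by rewrite invr_ge0 ltW.
have /andP[M1 M2] := truncn_itv ie0; rewrite -/M in M1 M2.
have Me : M%:R * eta <= 1 by rewrite -ler_pdivlMr// div1r.
pose x (j : nat) : R := - 1 + eta + 2 * eta * j%:R.
have x2 (j : 'I_M) : eta ^+ 2 <= 1 - x j ^+ 2.
  have jM : j%:R + 1 <= M%:R :> R by rewrite natr1 ler_nat.
  have j0 : 0 <= j%:R :> R by [].
  have : x j <= 1 - eta.
    by have := ler_wpM2r (ltW e0) jM; rewrite /x; nra.
  have : eta - 1 <= x j.
    by have := mulr_ge0 (ltW e0) j0; rewrite /x; nra.
  nra.
pose om (i : 'I_M * bool) : R[i] :=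
  (x i.1 +i* ((-1) ^+ i.2 * Num.sqrt (1 - x i.1 ^+ 2)))%C.
have x0 (j : 'I_M) : 0 <= 1 - x j ^+ 2 by apply: le_trans (x2 j); exact: sqr_ge0.
have om1 i : nsq (om i) = 1.
  by rewrite /nsq /om /= exprMn sqrr_sign mul1r sqr_sqrtr// subrKC.
exists M, om; split => //.
  move=> z i j hi hj; apply/eqP.
  have := in_mobius_disc_close A81 (om1 i) (om1 j) hi hj.
  rewrite -/eta cmod_lt; last by apply: mulr_ge0 => //; exact: ltW.
  move=> lt.
  case: i j lt {hi hj} => [i s] [j s'].
  have [<-|ij] := eqVneq i j.
    have [->//|ss] := eqVneq s s'.
    have -> : nsq (om (i, s) - om (i, s')) = 4 * (1 - x i ^+ 2).
      have sq := sqr_sqrtr (x0 i); rewrite /nsq /om /= subrr expr0n /= add0r -[in RHS]sq.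
      by case: s s' ss => [] [] //=; rewrite ?expr0 ?expr1 => _; ring.
    by have := x2 i; nra.
  rewrite /nsq /= => lt; exfalso.
  have : (2 * eta) ^+ 2 <= (x i - x j) ^+ 2.
    have -> : x i - x j = 2 * eta * (i%:R - j%:R) by rewrite /x; ring.
    rewrite [leRHS]exprMn ler_peMr ?sqr_ge0//.
    have /orP[] : (i < j)%N || (j < i)%N by rewrite -neq_ltn.
      by rewrite -(ler_nat R) -natr1 => ?; nra.
    by rewrite -(ler_nat R) -natr1 => ?; nra.
  by apply/negP; rewrite -ltNge (le_lt_trans _ lt)// lerDl sqr_ge0.
have h0 : 1 - hcenter A ^+ 2 = 4 * A / (A + 1) ^+ 2.
  by rewrite /hcenter; field; apply/eqP; lra.
have hp : 0 < 1 - hcenter A ^+ 2 by rewrite h0 divr_gt0 ?exprn_gt0//; lra.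
rewrite -mulrA -ler_pdivrMr ?mulr_gt0//.
apply: (@le_trans _ _ (eta^-1 - 1)); last by move: M2; rewrite -natr1; lra.
rewrite ler_pdivrMr ?mulr_gt0// h0 etaE.
have -> : ((8 * A / (3 * (A ^+ 2 - 1)))^-1 - 1) * (2 * (4 * A / (A + 1) ^+ 2)) =
   (3 * (A ^+ 2 - 1) - 8 * A) / (A + 1) ^+ 2.
  by field; rewrite !lt0r_neq0//; lra.
rewrite ler_pdivlMr ?exprn_gt0//; first nra.
by lra.
Qed.

End packing.

(** * The lower bound *)

Section lower_bound.
Variable R : realType.
Local Notation mR := (measurableTypeR R).
Implicit Types (f : {poly R[i]}) (z : R[i]) (A r : R).

(** The annulus that contains the discs of the row of parameter [A]. *)
Definition row_annulus A z : bool :=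
  (A - 3) / (A + 3) < cmod z < (3 * A - 1) / (3 * A + 1).

Lemma measurable_hdens_indicator f (b : R[i] -> bool) :
  measurable_fun setT (fun p : mR * mR => b (toC p)) ->
  measurable_fun setT (fun p : mR * mR => (hdens f (toC p) * (b (toC p))%:R)%:E).
Proof.
move=> mb; apply/measurable_EFinP; apply: measurable_funM; first exact: measurable_hdens.
exact: measurable_bool_indicator.
Qed.

Lemma measurable_row_annulus A :
  measurable_fun setT (fun p : mR * mR => row_annulus A (toC p)).
Proof.
have mc : measurable_fun setT (fun p : mR * mR => cmod (toC p)).
  by apply: measurable_cmod; exact: measC_toC.
by apply: measurable_and; exact: measurable_fun_ltr.
Qed.

Lemma row_discrepancy_ge A f : 81 <= A ->
  ((10 ^- 4)%:E <= \int[dA R]_p (hdens f (toC p) * (row_annulus A (toC p))%:R)%:E)%E.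
Proof.
move=> A81; have [M [om [om1 omi Mh]]] := mobius_disc_row A81.
have a01 : 0 < hcenter A < 1.
  by rewrite /hcenter divr_gt0 ?ltr_pdivrMr; lra.
have h0 (b : bool) z : 0 <= hdens f z * b%:R by rewrite mulr_ge0 ?hdens_ge0.
set h := 1 - _ in Mh.
apply: (@le_trans _ _ (\sum_(i : 'I_M * bool) (4 / 9 * h * 10 ^- 4)%:E)%E).
  rewrite sumEFin lee_fin sumr_const card_prod card_ord card_bool -[_ *+ (M * 2)]mulr_natl natrM.
  have -> : M%:R * 2%:R * (4 / 9 * h * 10 ^- 4) = 4 / 9 * (M%:R * 2 * h) * 10 ^- 4 :> R.
    by ring.
  by rewrite ler_peMl ?invr_ge0 ?exprn_ge0//; move: Mh; lra.
apply: (@le_trans _ _ (\sum_(i : 'I_M * bool) \int[dA R]_p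
    (hdens f (toC p) * (in_mobius_disc (hcenter A) (om i) (toC p))%:R)%:E)%E).
  by apply: lee_sum => i _; exact: mobius_disc_discrepancy.
rewrite -ge0_integral_sum//; last 2 first.
- by move=> i; apply: measurable_hdens_indicator; exact: measurable_in_mobius_disc.
- by move=> i p _; rewrite lee_fin.
apply: ge0_le_integral => //.
- by move=> p _; apply: sume_ge0 => i _; rewrite lee_fin.
- apply: emeasurable_sum => i.
  by apply: measurable_hdens_indicator; exact: measurable_in_mobius_disc.
- by apply: measurable_hdens_indicator; exact: measurable_row_annulus.
move=> p _; rewrite sumEFin lee_fin -mulr_sumr; apply: ler_wpM2l; first exact: hdens_ge0.
apply: sum_disjoint_indicators; first exact: omi.
by move=> i; exact: in_mobius_disc_annulus.
Qed.

(** The rows of parameters [9^2, ..., 9^(N + 1)] fit in the disc of radius [r]. *)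
Lemma rows_discrepancy_ge N r f : r < 1 -> 3 * 9 ^+ N.+1 <= (1 + r) / (1 - r) ->
  ((N%:R * 10 ^- 4)%:E <= \int[dA R]_(p in disc r) (hdens f (toC p))%:E)%E.
Proof.
move=> r1 Nr; pose A (k : 'I_N) : R := 9 ^+ k.+2.
have A81 k : 81 <= A k.
  by rewrite /A !exprS mulrA -[leLHS]mulr1 ler_pM ?exprn_ege1//; lra.
have h0 (b : bool) z : 0 <= hdens f z * b%:R by rewrite mulr_ge0 ?hdens_ge0.
have mh k := measurable_hdens_indicator f (measurable_row_annulus (A k)).
have md : measurable (disc r).
  have mc : measurable_fun setT (fun p : mR * mR => cmod (toC p)).
    by apply: measurable_cmod; exact: measC_toC.
  rewrite (_ : disc r = (fun p : mR * mR => cmod (toC p)) @^-1` `]-oo, r[).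
    by rewrite -[X in measurable X]setTI; apply: mc => //; exact: measurable_itv.
  by apply/seteqP; split => p; rewrite /disc /= in_itv.
apply: (@le_trans _ _ (\sum_(k < N) (10 ^- 4)%:E)%E).
  by rewrite sumEFin lee_fin sumr_const card_ord mulr_natl.
apply: (@le_trans _ _ (\sum_(k < N) \int[dA R]_p
    (hdens f (toC p) * (row_annulus (A k) (toC p))%:R)%:E)%E).
  by apply: lee_sum => k _; exact: row_discrepancy_ge.
rewrite -ge0_integral_sum//; last first.
  by move=> k p _; rewrite lee_fin.
rewrite [leRHS]integral_mkcond.
apply: ge0_le_integral => //.
- by move=> p _; apply: sume_ge0 => i _; rewrite lee_fin.
- by apply: emeasurable_sum => i.
- apply/(measurable_restrictT _ md); apply: measurable_funTS.
  by apply/measurable_EFinP; exact: measurable_hdens.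
move=> p _; rewrite sumEFin -mulr_sumr patchE.
apply: (@le_trans _ _ (hdens f (toC p) * (p \in disc r)%:R)%:E); last first.
  by case: ifP => _; rewrite ?mulr1 ?mulr0.
rewrite lee_fin; apply: ler_wpM2l; first exact: hdens_ge0.
apply: sum_disjoint_indicators => [i j /andP[i1 i2] /andP[j1 j2]|k /andP[_ k2]].
  apply/eqP; apply/negPn/negP; rewrite -val_eqE neq_ltn => /orP[] ij.
    apply: (row_annuli_disjoint (A81 i) _ i2 j1).
    by rewrite /A -exprS ler_eXn2l//; lra.
  apply: (row_annuli_disjoint (A81 j) _ j2 i1).
  by rewrite /A -exprS ler_eXn2l//; lra.
rewrite inE /disc /=; apply: (lt_le_trans k2).
have : 3 * A k <= (1 + r) / (1 - r).
  apply: le_trans Nr; rewrite ler_pM2l// /A ler_eXn2l//; first by rewrite ltnS ltn_ord.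
  by lra.
by have Ak := A81 k; rewrite ler_pdivlMr ?ler_pdivrMr; lra.
Qed.

Lemma discrepancyE r f : 0 <= r <= 1 ->
  discrepancy r f = ((ln (1 / (1 - r ^+ 2)))^-1%:E *
    \int[dA R]_(p in disc r) (hdens f (toC p))%:E)%E.
Proof.
move=> /andP[r0 r1]; congr (_ * _)%E; apply: eq_integral => p.
rewrite inE /disc /= cmod_lt// => pr.
rewrite cmod_sqr /hdens ger0_norm// subr_ge0 ltW// (lt_le_trans pr)//.
by rewrite expr_le1.
Qed.

Lemma expR_ge_taylor n (x : R) : 0 <= x ->
  \sum_(k < n) x ^+ k / k`!%:R <= expR x.
Proof.
move=> x0; rewrite /expR.
have -> : \sum_(k < n) x ^+ k / k`!%:R = [series exp_coeff x k]_k n.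
  by rewrite seriesEnat /= big_mkord.
apply: nondecreasing_cvgn_le; last exact: is_cvg_series_exp_coeff.
by apply: nondecreasing_series => k _ _; exact: exp_coeff_ge0.
Qed.

Lemma ln9_lt : ln (9 : R) < 9 / 4.
Proof.
have e : 0 < expR (9 / 4 : R) := expR_gt0 _.
rewrite -(@ltr_expR R) lnK ?posrE//.
have -> : 9 / 4 = 3 / 4 * 3%:R :> R by ring.
rewrite mulrC expRM_natl.
have : 21 / 10 <= expR (3 / 4 : R).
  apply: le_trans (expR_ge_taylor 4 _); last by lra.
  by rewrite !big_ord_recr big_ord0 /= !factS fact0 /=; lra.
move=> h; apply: (@lt_le_trans _ _ ((21 / 10) ^+ 3)); first lra.
by rewrite lerXn2r// nnegrE; lra.
Qed.

(** The rows in the disc of radius [r] number [N] with [(1 + r) / (1 - r) < 3 * 9^(N + 2)];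
    [N >= 27] absorbs the [3] in the resulting bound [9 (N + 3) / 4] of the logarithm. *)
Lemma discrepancy_ge : exists2 r0 : R, 0 < r0 < 1 & forall r f, r0 <= r < 1 ->
  ((4 / 10 ^+ 5)%:E <= discrepancy r f)%E.
Proof.
pose B : R := 3 * 9 ^+ 28.
have B2 : 2 <= B.
  by rewrite /B -[leLHS]mulr1 ler_pM ?exprn_ege1//; lra.
have BE : B = 3 * 9 ^+ 28 by []; clearbody B.
exists ((B - 1) / (B + 1)).
  by rewrite divr_gt0 ?ltr_pdivrMr; lra.
move=> r f /andP[r0 r1].
have rp : 0 < r by apply: lt_le_trans r0; rewrite divr_gt0; lra.
have XB : B <= (1 + r) / (1 - r).
  by move: r0; rewrite ler_pdivlMr ?ler_pdivrMr; lra.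
set X := (1 + r) / (1 - r) in XB.
have exX : exists n, X < 3 * 9 ^+ n.
  exists (Num.bound X); apply: lt_le_trans (archi_boundP _) _; first lra.
  apply: (@le_trans _ _ (9 ^+ Num.bound X)); last by rewrite ler_peMl ?exprn_ge0//; lra.
  by rewrite -natrX ler_nat ltnW// ltn_expl.
case: (ex_minnP exX) => n Xn nmin.
have n29 : (29 <= n)%N.
  rewrite leqNgt; apply/negP => n28; move: Xn; apply/negP; rewrite -leNgt.
  apply: le_trans XB; rewrite BE ler_pM2l// ler_eXn2l//; lra.
pose N := n.-2.
have nN : n = N.+2 by rewrite /N; case: (n) n29 => [|[]].
have NX : 3 * 9 ^+ N.+1 <= X.
  by rewrite leNgt; apply/negP => /nmin; rewrite nN ltnn.
have N27 : 27 <= N%:R :> R by rewrite (ler_nat R 27); rewrite nN in n29.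
have lX : ln (1 / (1 - r ^+ 2)) <= (N%:R + 3) * (9 / 4).
  have nr : 0 < 1 - r ^+ 2 by rewrite subr_gt0 expr_lt1// ltW.
  apply: (@le_trans _ _ (ln (9 ^+ n.+1))).
    rewrite ler_ln ?posrE ?exprn_gt0 ?divr_gt0//.
    apply: (@le_trans _ _ X); last first.
      apply: (le_trans (ltW Xn)); rewrite exprS ler_pM2r ?exprn_gt0//; lra.
    by rewrite ler_pdivrMr// /X mulrAC ler_pdivlMr; nra.
  have n3 : n.+1%:R = N%:R + 3 :> R by rewrite nN -(natrD _ N 3) addn3.
  rewrite lnXn// -[_ *+ n.+1]mulr_natl n3; apply: ler_wpM2l; first by rewrite addr_ge0.
  exact/ltW/ln9_lt.
have l0 : 0 < ln (1 / (1 - r ^+ 2)).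
  apply: ln_gt0; rewrite div1r invf_gt1 ?subr_gt0 ?expr_lt1 ?(ltW rp)//.
  by rewrite gtrBl exprn_gt0.
rewrite discrepancyE ?(ltW rp) ?(ltW r1)//.
apply: (@le_trans _ _ ((ln (1 / (1 - r ^+ 2)))^-1%:E * (N%:R * 10 ^- 4)%:E)%E); last first.
  apply: lee_wpmul2l; first by rewrite lee_fin invr_ge0 ltW.
  exact: rows_discrepancy_ge.
rewrite -EFinM lee_fin [leRHS]mulrC ler_pdivlMr//.
apply: (@le_trans _ _ (4 / 10 ^+ 5 * ((N%:R + 3) * (9 / 4)))).
  by apply: ler_wpM2l.
by lra.
Qed.

End lower_bound.

(** * Discrepancy integrals of a polynomial *)

Section upper_bound.
Variable R : realType.
Local Notation mR := (measurableTypeR R).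
Local Notation Re := (@complex.Re R).
Implicit Types (f : {poly R[i]}) (z : R[i]) (T : R).

(** On an annulus, the projection of [f] on the phase of the mode [z^(2m)] only sees the
    coefficient of that mode. *)
Lemma avg_band T (a b : R) m f : 0 < a -> a < b -> b <= T ->
  let g z := ((nsq z)^-1 ^+ m * (a <= nsq z < b)%R%:R) * Re (conjc z ^+ (2 * m) * f.[z]) in
  tame T g /\
  avg T g = Re f`_(2 * m) * ((b ^+ m.+1 - a ^+ m.+1) / m.+1%:R).
Proof.
move=> a0 ab bT g; set k := (2 * m)%N.
pose w (s : mR) : R := `|s|^-1 ^+ m * (a <= s < b)%R%:R.
have mw : measurable_fun setT w.
  apply: measurable_funM.
    apply: measurable_funX; apply: measurable_fun_inv => //.
  apply: measurable_bool_indicator.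
  by apply: measurable_and; [exact: measurable_fun_ler|exact: measurable_fun_ltr].
have tw : tame T (fun z => w (nsq z)).
  apply: (@tame_radial _ T w (a^-1 ^+ m)) => // s _; rewrite /w.
  case: (boolP (_ && _)) => [/andP[h1 _]|_]; last by rewrite mulr0 normr0 exprn_ge0// invr_ge0 ltW.
  have s0 : 0 < s by exact: lt_le_trans h1.
  rewrite mulr1 (gtr0_norm s0) ger0_norm ?exprn_ge0 ?invr_ge0 ?(ltW s0)//.
  by rewrite lerXn2r ?nnegrE ?invr_ge0 ?(ltW s0) ?(ltW a0)// lef_pV2.
pose S := (size f + k.+1)%N.
have wE z : w (nsq z) = (nsq z)^-1 ^+ m * (a <= nsq z < b)%R%:R.
  by rewrite /w ger0_norm ?nsq_ge0.
have gE : g = fun z => \sum_(l < S) w (nsq z) * Re (f`_l * conjc z ^+ k * z ^+ l).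
  apply/funext => z; rewrite /g (@horner_coef_wide _ S); last exact: leq_addr.
  rewrite mulr_sumr Re_sum mulr_sumr; apply: eq_bigr => l _.
  by rewrite wE; congr (_ * Re _); rewrite mulrCA mulrA.
rewrite gE; split; first by apply: tame_sum => l; exact: tame_mode.
rewrite avg_sum; last by move=> l; exact: tame_mode.
have kS : (k < S)%N by rewrite /S addnS ltnS leq_addl.
rewrite (bigD1 (Ordinal kS))//= big1 ?addr0; last first.
  by move=> l lk; apply: avg_mode0 => //; rewrite eq_sym.
have [tm <-] := @avg_annulus_monomial R T m a b (ltW a0) ab bT.
rewrite -avgZ//; apply: eq_avg => z _; rewrite wE.
case: (boolP (_ && _)) => [/andP[h1 _]|_]; last by rewrite !mulr0 mul0r.
have s0 : nsq z != 0 by rewrite gt_eqF// (lt_le_trans a0).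
rewrite -mulrA -exprMn conjcM_nsq -rmorphXn /= !mulr1.
have -> : Re (f`_k * (nsq z ^+ k)%:C%C) = Re f`_k * nsq z ^+ k.
  by case: (f`_k) => x y /=; rewrite mulr0 subr0.
rewrite mulrCA /k mul2n -addnn exprD; congr (_ * _).
by rewrite mulrA -exprMn mulVf// expr1n mul1r.
Qed.

(** On each of the consecutive annuli with squared radii [e n], [|f|] is at least its
    real part against the phase of the mode [2 m n]. *)
Lemma avg_cmod_ge T N (e : nat -> R) (m : nat -> nat) f :
  0 < e 0%N -> {homo e : x y / (x < y)%N >-> x < y} -> e N <= T ->
  \sum_(n < N) Re f`_(2 * m n) * ((e n.+1 ^+ (m n).+1 - e n ^+ (m n).+1) / (m n).+1%:R)
    <= avg T (fun z => cmod f.[z]).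
Proof.
move=> e0 einc eT.
have ele : {homo e : x y / (x <= y)%N >-> x <= y} by exact: ltW_homo.
have en n : 0 < e n by rewrite (lt_le_trans e0)// ele.
have band (n : 'I_N) := @avg_band T (e n) (e n.+1) (m n) f (en n) (einc _ _ (ltnSn n))
  (le_trans (ele _ _ (ltn_ord n)) eT).
rewrite (eq_bigr _ (fun n _ => esym (band n).2)) -avg_sum; last by move=> n; exact: (band n).1.
apply: le_avg; [by apply: tame_sum => n; exact: (band n).1|exact: tame_cmod_horner|].
move=> z _ /=.
pose c (n : nat) : bool := e n <= nsq z < e n.+1.
apply: (@le_trans _ _ (cmod f.[z] * \sum_(n < N) (c n)%:R)).
  rewrite mulr_sumr; apply: ler_sum => n _; rewrite /c.
  case: (boolP (_ && _)) => [/andP[h1 _]|_]; last by rewrite !mulr0 mul0r.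
  rewrite !mulr1 mulrC; have s0 : 0 < nsq z by rewrite (lt_le_trans (en n)).
  rewrite exprVn ler_pdivrMr ?exprn_gt0//; apply: le_trans (Re_le_cmod _) _.
  rewrite cmodM mulrC; apply: ler_wpM2l; first exact: cmod_ge0.
  by rewrite cmodX [cmod (conjc z)]cmodE nsq_conj -cmodE exprM cmod_sqr.
rewrite -[leRHS]mulr1; apply: ler_wpM2l; first exact: cmod_ge0.
apply: (@sum_disjoint_indicators R _ (fun n : 'I_N => c n) true) => // i j /andP[i1 i2] /andP[j1 j2].
apply/eqP; apply/negPn/negP; rewrite -val_eqE neq_ltn => /orP[] ij.
  by have := lt_le_trans i2 (le_trans (ele _ _ ij) j1); rewrite ltxx.
by have := lt_le_trans j2 (le_trans (ele _ _ ij) i1); rewrite ltxx.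
Qed.

Lemma avg_hdens T f : 0 < T < 1 -> tame T (hdens f) /\
  avg T (hdens f) = avg T (fun z => (1 - nsq z) * nsq f.[z])
    - 2 * avg T (fun z => cmod f.[z]) + ln (1 / (1 - T)).
Proof.
move=> /andP[T0 T1].
have mn : measurable_fun setT (fun s : mR => `|1 - s|^-1).
  apply: measurable_fun_inv => //; apply: (measurableT_comp (@normr_measurable _ _)).
  exact: measurable_funB.
have x1 (x : R) : 0 <= x <= T -> 0 < 1 - x.
  by move=> /andP[_ xT]; rewrite subr_gt0 (le_lt_trans xT).
have i0 (x : R) : 0 <= x <= T -> 0 <= `|1 - x|^-1 by rewrite invr_ge0.
have dF (x : R) : 0 <= x <= T ->
    is_derive x 1 (fun s : R => - ln (1 - s)) `|1 - x|^-1.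
  move=> /x1 x0; have d1 : is_derive x 1 (fun s : R => 1 - s) (-1).
    by rewrite -[X in is_derive _ _ _ X]add0r; apply: is_deriveB.
  have := is_deriveN (@is_derive1_comp R (@ln R) (fun s : R => 1 - s) x _ _ (is_derive1_ln x0) d1).
  by rewrite mulrN1 opprK gtr0_norm.
have cf (x : R) : 0 <= x <= T -> {for x, continuous (fun s : R => `|1 - s|^-1)}.
  move=> /x1 x0; apply: cvgV; first by rewrite normr_eq0 gt_eqF.
  by apply: cvg_norm; apply: cvgB; [exact: cvg_cst|exact: cvg_id].
have [ti ai] := avg_annulus (lexx 0) T0 (lexx T) mn i0 dF cf.
have ts : tame T (fun z => (1 - nsq z) * nsq f.[z]).
  by apply: tameM; [apply: tameB; [exact: tame_cst|exact: tame_nsq]|exact: tame_nsq_horner].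
have tc := tame_cmod_horner T f.
have E z : nsq z < T -> hdens f z = (1 - nsq z) * nsq f.[z] +
    (- 2) * cmod f.[z] + `|1 - nsq z|^-1 * (0 <= nsq z < T)%R%:R.
  move=> zT; rewrite nsq_ge0 zT mulr1 /hdens -[nsq f.[z] in RHS]cmod_sqr.
  have n0 : 0 < 1 - nsq z by rewrite subr_gt0 (lt_trans zT).
  by rewrite (gtr0_norm n0); field; rewrite gt_eqF.
have tt : tame T (fun z => (1 - nsq z) * nsq f.[z] + (- 2) * cmod f.[z] +
    `|1 - nsq z|^-1 * (0 <= nsq z < T)%R%:R).
  by apply: tameD => //; apply: tameD => //; apply: tameM => //; exact: tame_cst.
split.
  have [M tM] := tt.2; split; first exact: measurable_hdens.
  by exists M => z zT; rewrite E// tM.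
have tcc : tame T (fun z => (- 2) * cmod f.[z]) by apply: tameM => //; exact: tame_cst.
rewrite (eq_avg E) avgD//; last exact: tameD.
rewrite avgD// avgZ// mulNr ai subr0 ln1 oppr0 subr0.
by rewrite div1r lnV ?posrE ?subr_gt0.
Qed.

Lemma avg_mode_le1 T k : 0 < T <= 1 ->
  avg T (fun z => (1 - nsq z) * nsq z ^+ k) <= (k.+1%:R * k.+2%:R)^-1.
Proof.
move=> /andP[T0 T1].
rewrite (eq_avg (G := fun z => nsq z ^+ k - nsq z ^+ k.+1)); last first.
  by move=> z _; rewrite mulrBl mul1r exprS.
have tX n : tame T (fun z => nsq z ^+ n) by apply: tameX; exact: tame_nsq.
rewrite avgB// !avg_moment//.
have h : T ^+ k.+1 * (k.+2%:R - k.+1%:R * T) <= 1.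
  elim: k => [|k IH]; first by rewrite expr1 mul1r; have := sqr_ge0 (1 - T); nra.
  apply: le_trans IH; rewrite -subr_ge0.
  have -> : T ^+ k.+1 * (k.+2%:R - k.+1%:R * T) - T ^+ k.+2 * (k.+3%:R - k.+2%:R * T) =
     k.+2%:R * T ^+ k.+1 * (1 - T) ^+ 2.
    by rewrite (exprS _ k.+1) -!natr1; ring.
  by apply: mulr_ge0; [rewrite mulr_ge0 ?exprn_ge0 ?(ltW T0)|exact: sqr_ge0].
have -> : T ^+ k.+1 / k.+1%:R - T ^+ k.+2 / k.+2%:R =
   (T ^+ k.+1 * (k.+2%:R - k.+1%:R * T)) / (k.+1%:R * k.+2%:R).
  have := ltr0Sn R k; have := ltr0Sn R k.+1; rewrite (exprS _ k.+1).
  move: k.+1%:R k.+2%:R => x y y0 x0; field.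
  by rewrite !gt_eqF.
by rewrite -[leRHS]mul1r ler_wpM2r// invr_ge0 mulr_ge0.
Qed.

End upper_bound.

(** * Lacunary polynomials *)

Section lacunary_polynomials.
Variable R : realType.
Implicit Types (T : R) (c : nat -> R) (k : nat -> nat).

(** The polynomial with coefficient [c n] at the exponent [k n], for [n < N]. *)
Definition lacunary N c k : {poly R[i]} := \sum_(n < N) (c n)%:C%C *: 'X^(k n).

Lemma coef_lacunary N c k j :
  (lacunary N c k)`_j = (\sum_(n < N) c n * (j == k n)%:R)%:C%C.
Proof.
rewrite coef_sum rmorph_sum; apply: eq_bigr => n _.
by rewrite coefZ coefXn rmorphM /= rmorph_nat.
Qed.

Lemma lacunary_coef N c k (n : 'I_N) : injective k -> (lacunary N c k)`_(k n) = (c n)%:C%C.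
Proof.
move=> kI; rewrite coef_lacunary (bigD1 n)//= eqxx mulr1 big1 ?addr0// => i ni.
by rewrite (inj_eq kI) eq_sym val_eqE (negbTE ni) mulr0.
Qed.

Lemma nsq_coef_lacunary N c k j : injective k ->
  nsq (lacunary N c k)`_j = \sum_(n < N) c n ^+ 2 * (j == k n)%:R.
Proof.
move=> kI; case: (pickP (fun n : 'I_N => j == k n)) => [n /eqP jn|j0].
  rewrite [in LHS]jn lacunary_coef// nsq_real (bigD1 n)//= jn eqxx mulr1 big1 ?addr0// => i ni.
  by rewrite (inj_eq kI) eq_sym val_eqE (negbTE ni) mulr0.
rewrite coef_lacunary !big1 ?nsq0// => n _; by rewrite j0 mulr0.
Qed.

Lemma avg_lacunary_le T N c k : injective k -> 0 < T <= 1 ->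
  avg T (fun z => (1 - nsq z) * nsq (lacunary N c k).[z]) <=
  \sum_(n < N) c n ^+ 2 * ((k n).+1%:R * (k n).+2%:R)^-1.
Proof.
move=> kI T01.
rewrite (@avg_parseval R T (fun s => 1 - s)); last first.
  by apply: tameB; [exact: tame_cst|exact: tame_nsq].
apply: (@le_trans _ _ (\sum_(j < size (lacunary N c k)) \sum_(n < N)
    c n ^+ 2 * ((j == k n :> nat)%:R * (j.+1%:R * j.+2%:R)^-1))).
  apply: ler_sum => j _; under [leRHS]eq_bigr do rewrite mulrA.
  rewrite -mulr_suml -nsq_coef_lacunary//; apply: ler_wpM2l; first exact: nsq_ge0.
  exact: avg_mode_le1.
rewrite exchange_big /=; apply: ler_sum => n _; rewrite -mulr_sumr.
apply: ler_wpM2l; first exact: sqr_ge0.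
have u0 : 0 <= ((k n).+1%:R * (k n).+2%:R : R)^-1 by rewrite invr_ge0 mulr_ge0.
have [kS|kS] := ltnP (k n) (size (lacunary N c k)); last first.
  rewrite big1// => j _; rewrite (_ : (_ == _) = false) ?mul0r//.
  by apply/negbTE; rewrite neq_ltn (leq_trans (ltn_ord j) kS).
rewrite (bigD1 (Ordinal kS))//= eqxx mul1r big1 ?addr0// => j.
by rewrite -val_eqE /= => /negbTE ->; rewrite mul0r.
Qed.

End lacunary_polynomials.

(** * Numerical estimates *)

Section upper_numerics.
Variable R : realType.
Implicit Types (a : R).

Lemma ln20_lt : ln (20 : R) < 4 * (7489 / 10 ^+ 4 + 333 / 10 ^+ 7).
Proof.
set x : R := _ + _.
have x0 : 0 <= x by rewrite /x; lra.
rewrite -(@ltr_expR R) lnK ?posrE// expRM_natl.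
have : 2 + 1147 / 10 ^+ 4 + 427 / 10 ^+ 7 <= expR x.
  apply: le_trans (expR_ge_taylor 10 x0).
  rewrite !big_ord_recr big_ord0 /= !factS fact0 /x /=.
  lra.
move=> h; apply: (@lt_le_trans _ _ ((2 + 1147 / 10 ^+ 4 + 427 / 10 ^+ 7) ^+ 4)); first lra.
by rewrite lerXn2r// nnegrE; lra.
Qed.

(** A value of [b] just below [q - q^20] for [q = 0.8541]. *)
Lemma band_mass_gt : 8114 / 10 ^+ 4 + 248 / 10 ^+ 7 <
  8541 / 10 ^+ 4 - (8541 / 10 ^+ 4) ^+ 20 :> R.
Proof.
have u0 : 0 <= (8541 / 10 ^+ 4) ^+ 5 :> R by apply: exprn_ge0; lra.
have h : (8541 / 10 ^+ 4) ^+ 5 <= 4545 / 10 ^+ 4 + 1018 / 10 ^+ 8 :> R by lra.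
have : (8541 / 10 ^+ 4) ^+ 20 <= (4545 / 10 ^+ 4 + 1018 / 10 ^+ 8) ^+ 4 :> R.
  rewrite (exprM _ 5 4); move: u0 h; move: (_ ^+ 5) => u u0 h.
  by apply: lerXn2r; [rewrite nnegrE|rewrite nnegrE; exact: le_trans h|].
move: (_ ^+ 20) => z hz; lra.
Qed.

Lemma discrepancy_constant :
  (1 - (12 * 10 ^+ 3 + 87) / 10 ^+ 5) * ln 20 < 4 * (8114 / 10 ^+ 4 + 248 / 10 ^+ 7) ^+ 2 :> R.
Proof. by have := ln20_lt; lra. Qed.

(** The mass of one band falls short of [q - q^20], [q = e^-a], by at most [5 / m]. *)
Lemma expR_band_ge a m : 0 < a <= 1 -> (400 <= m)%N ->
  expR (- a) - expR (- a) ^+ 20 - 5 / m%:R <=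
  m%:R * (((1 - a / m%:R) ^+ m.+1 - (1 - 20 * a / m%:R) ^+ m.+1) / m.+1%:R).
Proof.
move=> /andP[a0 a1] m400.
have M400 : 400 <= m%:R :> R by rewrite (ler_nat R 400).
set M := m%:R in M400 *.
have M0 : 0 < M by lra.
set x := a / M.
have x0 : 0 < x by rewrite divr_gt0.
have x1 : x <= 1 / 400 by rewrite /x ler_pdivrMr//; nra.
have -> : 20 * a / M = 20 * x by rewrite /x mulrA.
have lo : expR (- a) - 4 / M <= (1 - x) ^+ m.+1.
  have y1 : expR (- (x / (1 - x))) <= 1 - x.
    rewrite expRN -[leRHS]invrK lef_pV2 ?posrE ?expR_gt0 ?invr_gt0//; last lra.
    apply: le_trans (expR_ge1Dx _).
    by rewrite (_ : 1 + x / (1 - x) = (1 - x)^-1)//; field; apply/eqP; lra.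
  apply: (@le_trans _ _ (expR (- (x / (1 - x))) ^+ m.+1)); last first.
    by rewrite lerXn2r// nnegrE ?expR_ge0//; lra.
  rewrite -expRM_natl.
  apply: (@le_trans _ _ (expR (- a) * expR (- (4 / M)))).
    have h1 := expR_ge1Dx (- (4 / M)); have h2 : expR (- a) <= 1 by rewrite expR_le1; lra.
    have h3 := expR_gt0 (- a); have h4 : 0 <= 4 / M by rewrite divr_ge0// ltW.
    nra.
  rewrite -expRD ler_expR mulrN -opprD lerN2 -natr1 -/M.
  have -> : (M + 1) * (x / (1 - x)) = a + a * (1 + a) / (M - a).
    by rewrite /x; field; apply/andP; split; apply/eqP; lra.
  have -> : 4 / M = 4 * (1 - x) / (M - a).
    by rewrite /x; field; apply/andP; split; apply/eqP; lra.
  have aa : a * (1 + a) <= 2 by nra.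
  by rewrite lerD2l ler_pM2r ?invr_gt0; lra.
have hi : (1 - 20 * x) ^+ m.+1 <= expR (- a) ^+ 20.
  have x20 : 0 <= 1 - 20 * x by lra.
  apply: (@le_trans _ _ ((1 - 20 * x) ^+ m)).
    by rewrite exprSr ler_piMr ?exprn_ge0//; lra.
  have -> : expR (- a) ^+ 20 = expR (- (20 * x)) ^+ m.
    by rewrite -!expRM_natl; congr expR; rewrite -/M /x; field; rewrite gt_eqF.
  by rewrite lerXn2r// ?nnegrE ?expR_ge0// expR_ge1Dx.
have p1 : (1 - x) ^+ m.+1 <= 1 by rewrite exprn_ile1//; lra.
have p0 : 0 <= (1 - 20 * x) ^+ m.+1 by rewrite exprn_ge0//; lra.
move: lo hi p1 p0; move: ((1 - x) ^+ m.+1) ((1 - 20 * x) ^+ m.+1) (expR _ ^+ 20).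
move=> P Q E lo hi p1 p0.
have -> : M * ((P - Q) / m.+1%:R) = (P - Q) - (P - Q) / (M + 1).
  by rewrite -natr1 -/M; field; apply/eqP; lra.
have : (P - Q) / (M + 1) <= 1 / M.
  apply: (@le_trans _ _ (1 / (M + 1))); first by rewrite ler_pM2r ?invr_gt0; lra.
  by rewrite !div1r lef_pV2 ?posrE; lra.
have -> : 5 / M = 4 / M + 1 / M by rewrite -mulrDl; congr (_ / _); ring.
lra.
Qed.

End upper_numerics.

(** * The upper bound and the theorem *)

Section conclusion.
Variable R : realType.
Local Notation mR := (measurableTypeR R).
Implicit Types (f : {poly R[i]}) (r : R).

Lemma discrepancy_avg r f : 0 < r < 1 ->
  discrepancy r f = ((ln (1 / (1 - r ^+ 2)))^-1 * avg (r ^+ 2) (hdens f))%:E.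
Proof.
move=> /andP[r0 r1]; have r2 : 0 < r ^+ 2 < 1 by rewrite exprn_gt0// expr_lt1// ltW.
rewrite discrepancyE ?(ltW r0) ?(ltW r1)// EFinM avgE; last exact: (avg_hdens f r2).1.
rewrite (_ : disc r = sdisc (r ^+ 2))//.
by apply/seteqP; split => p; rewrite /disc /sdisc /= cmod_lt// ltW.
Qed.

(** The test polynomial with modes [2 m_n] and coefficients [4 b m_n], for an arbitrary
    sequence of bands on which it captures mass at least [b]. *)
Lemma avg_hdens_lacunary N (e : nat -> R) (m : nat -> nat) (b : R) :
  0 < b -> 0 < e 0%N -> {homo e : x y / (x < y)%N >-> x < y} -> (0 < N)%N -> e N < 1 ->
  injective m ->
  (forall n, b <= (m n)%:R *
     ((e n.+1 ^+ (m n).+1 - e n ^+ (m n).+1) / (m n).+1%:R)) ->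
  exists f, avg (e N) (hdens f) <= ln (1 / (1 - e N)) - N%:R * (4 * b ^+ 2).
Proof.
move=> b0 e0 einc N0 eN1 mI hb.
have eN0 : 0 < e N by rewrite (lt_trans e0)// einc.
pose c n : R := 4 * b * (m n)%:R.
pose k n := (2 * m n)%N.
have kI : injective k by move=> i j; rewrite /k => /eqP; rewrite eqn_pmul2l// => /eqP/mI.
exists (lacunary N c k).
rewrite (avg_hdens _ _).2; last by rewrite eN0.
have l1 : avg (e N) (fun z => (1 - nsq z) * nsq (lacunary N c k).[z]) <= N%:R * (4 * b ^+ 2).
  apply: le_trans (avg_lacunary_le N c kI _) _; first by rewrite eN0 ltW.
  apply: (@le_trans _ _ (\sum_(n < N) 4 * b ^+ 2)); last first.
    by rewrite sumr_const card_ord -[4 * b ^+ 2 *+ N]mulr_natl.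
  apply: ler_sum => n _; rewrite ler_pdivrMr ?mulr_gt0 ?ltr0Sn//.
  rewrite /c /k -!natr1 natrM; set x := (m n)%:R; have x0 : 0 <= x by [].
  by have := sqr_ge0 b; nra.
have l2 : N%:R * (4 * b ^+ 2) <= avg (e N) (fun z => cmod (lacunary N c k).[z]).
  apply: le_trans (avg_cmod_ge m (lacunary N c k) e0 einc (lexx _)).
  apply: (@le_trans _ _ (\sum_(n < N) 4 * b ^+ 2)).
    by rewrite sumr_const card_ord -[4 * b ^+ 2 *+ N]mulr_natl.
  apply: ler_sum => n _; rewrite (lacunary_coef c n kI) /= /c -mulrA.
  by rewrite expr2 mulrA ler_pM2l ?mulr_gt0.
lra.
Qed.

(** For numbers [q], [b], [c] that satisfy the strict inequalities of the limit, some
    radius arbitrarily close to [1] and some polynomial have discrepancy at most [c]. *)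
Lemma discrepancy_le (q b c d : R) : 1 / 2 <= q -> q < 1 -> 0 < b -> b < q - q ^+ 20 ->
  0 < c < 1 -> (1 - c) * ln 20 < 4 * b ^+ 2 -> 0 < d ->
  exists r f, 1 - d < r < 1 /\ (discrepancy r f <= c%:E)%E.
Proof.
move=> q2 q1 b0 bq /andP[c0 c1] bc d0.
have q0 : 0 < q by lra.
pose a := - ln q.
have qE : expR (- a) = q by rewrite /a opprK lnK.
have a0 : 0 < a by rewrite /a oppr_gt0 ln_lt0// q0.
have a1 : a <= 1.
  rewrite -lerN2 -ler_expR qE; apply: le_trans q2.
  by rewrite expRN div1r lef_pV2 ?posrE ?expR_gt0//; have := expR_ge1Dx (1 : R); lra.
have [n0 n0P] : exists n0, (400 <= 20 ^ n0)%N /\ 5 / (q - q ^+ 20 - b) <= 20 ^+ n0.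
  have x0 : 0 < 5 / (q - q ^+ 20 - b) by rewrite divr_gt0//; lra.
  exists (Num.bound (5 / (q - q ^+ 20 - b))).+2; split.
    move: (Num.bound _) => B; rewrite -[B.+2]add2n expnD.
    by apply: (@leq_pmulr (20 ^ 2)%N); rewrite expn_gt0.
  apply: (le_trans (ltW (archi_boundP (ltW x0)))).
  rewrite -natrX ler_nat; apply/ltnW/(leq_trans (ltn_expl _ (isT : (1 < 20)%N))).
  by rewrite leq_exp2l//; do 2 apply: leqW.
pose m n := (20 ^ (n0 + n))%N.
have mR n : (m n)%:R = 20 ^+ (n0 + n) :> R by rewrite /m natrX.
have m400 n : (400 <= m n)%N by rewrite (leq_trans n0P.1)// leq_exp2l// leq_addr.
have M400 n : 400 <= (m n)%:R :> R by rewrite (ler_nat R 400).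
have mS n : (m n.+1)%:R = 20 * (m n)%:R :> R by rewrite !mR addnS exprS.
pose e n : R := 1 - 20 * a / (m n)%:R.
have eS n : e n.+1 = 1 - a / (m n)%:R.
  by rewrite /e mS; congr (1 - _); field; have := M400 n; lra.
have e0 : 0 < e 0%N.
  by rewrite /e subr_gt0 ltr_pdivrMr; have := M400 0%N; lra.
have einc : {homo e : x y / (x < y)%N >-> x < y}.
  apply: homo_ltn => [? ? ?|n]; first exact: lt_trans.
  by rewrite eS /e ltrD2l ltrN2 ltr_pM2r ?invr_gt0; have := M400 n; lra.
have mI : injective m.
  by move=> i j /eqP; rewrite /m eqn_exp2l// eqn_add2l => /eqP.
have hb n : b <= (m n)%:R * ((e n.+1 ^+ (m n).+1 - e n ^+ (m n).+1) / (m n).+1%:R).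
  rewrite eS; apply: le_trans (expR_band_ge _ (m400 n)); last by rewrite a0.
  rewrite qE; suff : 5 / (m n)%:R <= q - q ^+ 20 - b by lra.
  have D0 : 0 < q - q ^+ 20 - b by lra.
  rewrite ler_pdivrMr; last by have := M400 n; lra.
  rewrite mulrC -ler_pdivrMr// (le_trans n0P.2)// mR ler_eXn2l//; first exact: leq_addr.
  by lra.
(* The logarithm is affine in the number of bands; [kap] is the gain per band, which
   eventually exceeds the constant term. *)
pose C := n0%:R * ln 20 - ln (20 * a).
have LE N : ln (1 / (1 - e N)) = N%:R * ln 20 + C.
  rewrite /e subKr div1r invf_div ln_div ?posrE ?mulr_gt0//; last first.
    by have := M400 N; lra.
  by rewrite mR lnXn// -[_ *+ _]mulr_natl natrD /C; ring.
pose kap := 4 * b ^+ 2 - (1 - c) * ln 20.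
have k0 : 0 < kap by rewrite subr_gt0.
have [N [N0 [NC Nd]]] : exists N, (0 < N)%N /\ (1 - c) * C <= N%:R * kap /\
    20 * a / d < (m N)%:R.
  pose x := `|(1 - c) * C| / kap + 20 * a / d.
  have y0 : 0 < 20 * a / d by rewrite divr_gt0// mulr_gt0.
  have z0 : 0 <= `|(1 - c) * C| / kap by rewrite divr_ge0// ltW.
  have x0 : 0 <= x by rewrite addr_ge0// ltW.
  have xb := archi_boundP x0.
  exists (Num.bound x); split; last split.
  - by rewrite -(ltr_nat R) (le_lt_trans x0).
  - rewrite (le_trans (ler_norm _))// -ler_pdivrMr// (le_trans _ (ltW xb))//.
    by rewrite /x lerDl ltW.
  - rewrite (@le_lt_trans _ _ x) ?lerDr// (lt_trans xb)// ltr_nat.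
    by rewrite (leq_trans (ltn_expl _ (isT : 1 < 20)%N))// leq_exp2l// leq_addl.
have eN1 : e N < 1.
  by rewrite /e gtrBl divr_gt0 ?mulr_gt0//; have := M400 N; lra.
have eN0 : 0 < e N by rewrite (lt_trans e0)// einc.
have [f fN] := avg_hdens_lacunary b0 e0 einc N0 eN1 mI hb.
pose r := Num.sqrt (e N).
have r2 : r ^+ 2 = e N by rewrite sqr_sqrtr// ltW.
have r0 : 0 < r by rewrite sqrtr_gt0.
have r1 : r < 1 by rewrite -sqrtr1 ltr_sqrt.
exists r, f; split.
  rewrite r1 andbT; apply: (@lt_le_trans _ _ (e N)).
    rewrite /e ltrD2l ltrN2 ltr_pdivrMr; last by have := M400 N; lra.
    by rewrite [ltRHS]mulrC -ltr_pdivrMr.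
  by rewrite -r2 expr2 ler_piMr// ltW.
rewrite discrepancy_avg ?r0// r2 lee_fin mulrC.
have L0 : 0 < ln (1 / (1 - e N)).
  by rewrite ln_gt0// div1r invf_gt1 ?subr_gt0// gtrBl.
rewrite ler_pdivrMr//; apply: (le_trans fN).
rewrite LE -subr_ge0; have -> : c * (N%:R * ln 20 + C) - (N%:R * ln 20 + C - N%:R * (4 * b ^+ 2)) =
   N%:R * kap - (1 - c) * C by rewrite /kap; ring.
by rewrite subr_ge0.
Qed.

End conclusion.

Theorem theorem1p5p3 (R : realType) :
  ((321 / 100 * 10 ^- 5)%:E < rhoH R)%E /\
  (rhoH R <= ((12 * 10 ^+ 3 + 87) / 10 ^+ 5)%:E)%E.
Proof.
rewrite /rhoH limf_einfE; split.
  have [r0 /andP[r00 r01] dge] := discrepancy_ge R.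
  apply: (@lt_le_trans _ _ (4 / 10 ^+ 5 : R)%:E); first by rewrite lte_fin; lra.
  apply: le_ereal_sup_tmp.
  pose V : set R := [set r | r0 <= r < 1].
  exists (ereal_inf ((fun r : R => ereal_inf [set discrepancy r f | f in [set: {poly R[i]}]]) @` V)).
    exists V => //; near=> r; apply/andP; split; last by near: r; exact: nbhs_left_lt.
    by near: r; apply: nbhs_left_ge.
  apply: le_ereal_inf_tmp => _ [r Vr <-].
  by apply: le_ereal_inf_tmp => _ [f _ <-]; exact: dge.
apply: ge_ereal_sup => _ [V V1 <-].
have [d /= d0 dV] := V1.
have [r [f [/andP[rd r1] fle]]] : exists r f, 1 - d < r < 1 /\
    (discrepancy r f <= ((12 * 10 ^+ 3 + 87) / 10 ^+ 5)%:E)%E.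
  apply: (discrepancy_le (q := 8541 / 10 ^+ 4) (b := 8114 / 10 ^+ 4 + 248 / 10 ^+ 7)) d0.
  - lra.
  - lra.
  - lra.
  - exact: band_mass_gt.
  - by apply/andP; split; lra.
  - exact: discrepancy_constant.
apply: le_trans fle.
apply: (@le_trans _ _ (ereal_inf [set discrepancy r f | f in [set: {poly R[i]}]])).
  apply: ereal_inf_lbound; exists r => //; apply: dV => //=.
  by rewrite ger0_norm ?subr_ge0 ?(ltW r1)//; lra.
by apply: ereal_inf_lbound; exists f.
Unshelve. all: by end_near.
Qed.
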